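(* For almost every $X=(X_k)_{k\in\mathbb{N}}\in\{0,1\}^{\mathbb{N}}$ with respect to the balanced Bernoulli measure, for every $k\in\mathbb{N}$: $$\lim_{n\to+\infty}\widetilde m_{2k}(a_X(n))=\frac{(2k)!}{2^kk!}\qquad\text{and}\qquad\lim_{n\to+\infty}\widetilde m_{2k+1}(a_X(n))=0,$$ which are the moments of the normal law $\mathcal{N}(0,1)$. Here $a_X(n)=\sum_{j=0}^nX_j2^j$ and, for $n\ge1$ and $k\in\mathbb{N}$, $\widetilde m_k(a_X(n))=\dfrac{\sqrt{2^k}\,m_k(a_X(n))}{n^{k/2}}$ with $m_k(a)=\sum_{d\in\mathbb{Z}}\mu_a(d)\,d^k$.
   Context: $\mathbb{N}=\{0,1,2,\dots\}$. For $n\in\mathbb{N}$, $s_2(n)$ is the number of digits $1$ in the binary expansion of $n$. For $a\in\mathbb{N}$, $\mu_a$ is the probability measure on $\mathbb{Z}$ given by $$\mu_a(d)=\lim_{N\to+\infty}\frac1N\#\{n<N : s_2(n+a)-s_2(n)=d\},\qquad d\in\mathbb{Z}$$ (it is known that these limits exist and define a probability measure, which has mean $0$). The quantity $\widetilde m_k(a_X(n))$ is the moment of order $k$ of the rescaled probability measure $\widetilde\mu_{a_X(n)}$ on $\sqrt{2/n}\,\mathbb{Z}$ defined by $\widetilde\mu_{a_X(n)}(d)=\mu_{a_X(n)}(\sqrt{n/2}\,d)$. The balanced Bernoulli measure on $\{0,1\}^{\mathbb{N}}$ is the product measure under which the coordinates $X_k$ are independent and take the values $0$ and $1$ with probability $\frac12$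 each. *)

(* Defs.v *)
From HB Require Import structures.
From mathcomp Require Import all_boot all_order all_algebra finmap.
From mathcomp Require Import all_classical all_reals all_analysis.
Set Implicit Arguments.
Unset Strict Implicit.
Unset Printing Implicit Defensive.
Import Order.TTheory GRing.Theory Num.Theory.
Import numFieldNormedType.Exports.
Local Open Scope classical_set_scope.
Local Open Scope ring_scope.

(* [odd (n %/ 2 ^ i)] is the binary digit of [n] of weight [2 ^ i]; it is 0 for
   [n <= i], because [n < 2 ^ n]. *)
Definition s2 (n : nat) : nat := (\sum_(i < n) odd (n %/ 2 ^ i))%N.

Definition mu {R : realType} (a : nat) (d : int) : R :=
  lim ((#|[pred n : 'I_N | (s2 (n + a))%:Z - (s2 n)%:Z == d]|%:R / N%:R : R)
       @[N --> \oo]).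

(* A sum over [int] of terms of both signs: [esum] is only meaningful for
   nonnegative terms.  The value is kept in [\bar R], so that a finite value
   entails the absolute convergence of the sum. *)
Definition moment {R : realType} (k a : nat) : \bar R :=
  let f (d : int) := (mu a d * d%:~R ^+ k)%:E in
  (\esum_(d in [set: int]) f^\+ d - \esum_(d in [set: int]) f^\- d)%E.

Definition a_of (X : nat -> bool) (n : nat) : nat :=
  (\sum_(j < n.+1) X j * 2 ^ j)%N.

Definition scaled_moment {R : realType} (k : nat) (X : nat -> bool) (n : nat) :
    \bar R :=
  ((Num.sqrt (2 ^+ k) / n%:R `^ (k%:R / 2))%:E * moment k (a_of X n))%E.

Definition coordinate_sets : set (set (nat -> bool)) :=
  \bigcup_k preimage_set_system setT (fun X : nat -> bool => X k) measurable.

(* {0,1}^N with the product sigma-algebra *)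
Definition bitsequences : measurableType _ :=
  g_sigma_algebraType coordinate_sets.

Definition mutually_independent d (T : measurableType d) (R : realType)
    (P : probability T R) (Y : nat -> T -> bool) : Prop :=
  forall (J : {fset nat}) (A : nat -> set bool),
    P (\bigcap_(j in [set` J]) Y j @^-1` A j) =
    (\prod_(j <- J) P (Y j @^-1` A j))%E.

Definition balanced_bernoulli (R : realType) (P : probability bitsequences R) :
    Prop :=
  mutually_independent P (fun k (X : bitsequences) => X k) /\
  forall (k : nat) (b : bool), P [set X : bitsequences | X k = b] = (2^-1)%:E.

(* Main.v *)
Require Import Defs.
From HB Require Import structures.
From mathcomp Require Import all_boot all_order all_algebra finmap.
From mathcomp Require Import all_classical all_reals all_analysis.
From mathcomp Require Import measurable_realfun ring lra zify.
Set Implicit Arguments.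
Unset Strict Implicit.
Unset Printing Implicit Defensive.
Import Order.TTheory GRing.Theory Num.Theory.
Import numFieldNormedType.Exports.
Local Open Scope classical_set_scope.
Local Open Scope ring_scope.

(* Conditioning on the last binary digit of n gives mu_(2a) = mu_a and
   mu_(2a+1)(d) = (mu_a(d-1) + mu_(a+1)(d+1)) / 2, hence linear recursions on the
   digits of a for the moments.  In these recursions the increments
   m_k(a+1) - m_k(a) are halved at each digit up to terms of lower order, so by
   induction on k, with G_k(v) the k-th moment of N(0,v) and v = m_2(a),
   m_k(a) = G_k(v) + O(l^((k-1)/2)) uniformly over the integers a with l digits.
   The binomial terms of the recursion match the heat equation satisfied by G_k.
   What remains is a law of large numbers for m_2(a_X(n)).  The quantity
   m_2(a) + (m_2(a+1) - m_2(a)) / 2 increases by 1/2 per digit, plus or minus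
   (according to the digit) a bounded quantity depending only on the higher
   digits; so its deviation from n/2 has variance O(n), and Borel-Cantelli along
   n = (m+1)^4 applies. *)

(** * Densities and the recursion for [mu] *)

(** The recursion at 2a+1 involves a+1, whose digits differ from those of a by carries; so m_k(a)
    cannot be followed alone. Bounding the increment m_k(a+1) - m_k(a) is too weak: over l digits
    the errors add up to O(l^((k-1)/2)) if each is O(l^((k-3)/2)), while the increment itself has
    order l^((k-2)/2). Its main term, C(k,2) G_(k-2)(v) times the increment of m_2, is therefore
    split off, and the first-order variation of G_k(v) absorbs it. The other obstacle is the order
    of the digits: the recursions add digits at the low end, while a_X(n) grows at the high end, so
    the orthogonality of the increments does not follow the sequence a_X(n). For a fixed n, all
    integers below 2^(n+1) are equally likely values of a_X(n), and the variance becomes a sum over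
    them, computed from the low end. This controls one n at a time, hence the sparse subsequence;
    the gaps are filled because m_2 is additive, up to a bounded error, under concatenation of
    blocks of digits. *)

Lemma s2_widen n m : (n <= m)%N -> s2 n = (\sum_(i < m) odd (n %/ 2 ^ i))%N.
Proof.
move=> nm; rewrite /s2 (big_ord_widen m (fun i => nat_of_bool (odd (n %/ 2 ^ i))) nm).
rewrite [RHS](bigID (fun i : 'I_m => (i < n)%N))/= [X in (_ + X)%N]big1 ?addn0// => i.
by rewrite -leqNgt => ni; rewrite divn_small// (leq_ltn_trans ni)// ltn_expl.
Qed.

Lemma s2_cons n (b : bool) : s2 (2 * n + b) = (s2 n + b)%N.
Proof.
rewrite (@s2_widen _ (2 * n + b).+1)// big_ord_recl/= divn1 oddD oddM/= oddb addnC.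
congr (_ + _)%N; rewrite (@s2_widen n (2 * n + b)); last first.
  by rewrite (leq_trans _ (leq_addr _ _))// leq_pmull.
apply: eq_bigr => i _; rewrite /bump/= add1n expnS divnMA; congr (nat_of_bool (odd (_ %/ _))).
by rewrite divnDl ?dvdn_mulr// mulKn// divn_small ?addn0//; case: (b).
Qed.

Lemma s2_double n : s2 (2 * n) = s2 n.
Proof. by have := s2_cons n false; rewrite !addn0. Qed.

Lemma s2_doubleS n : s2 (2 * n).+1 = (s2 n).+1.
Proof. by have := s2_cons n true; rewrite !addn1. Qed.

Lemma double_ind (P : nat -> Prop) : P 0%N ->
  (forall n, P n -> P (2 * n)%N) -> (forall n, P n -> P (2 * n).+1) ->
  forall n, P n.
Proof.
move=> P0 Pe Po; elim/ltn_ind => -[//|n] IH.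
have := odd_double_half n.+1; rewrite -mul2n.
case: (odd n.+1) => <-; rewrite ?add1n ?add0n; [apply: Po|apply: Pe]; apply: IH.
  by rewrite /= ltnS leq_uphalf_double -addnn leq_addr.
by rewrite /= ltnS leq_uphalf_double -addnn leq_addr.
Qed.

(** This confines [mu 1] to d <= 1, where the downward induction on d starts. *)
Lemma s2S_le n : (s2 n.+1 <= (s2 n).+1)%N.
Proof.
elim/double_ind: n => [|n _|n IH].
- by rewrite /s2 big_ord0 big_ord_recl big_ord0 divn1.
- by rewrite s2_doubleS s2_double.
- by rewrite s2_doubleS -[X in s2 X]/((2 * n).+2) -[(2 * n).+2]addn2 -[2%N in X in s2 X]muln1 -mulnDr addn1 s2_double (leq_trans IH).
Qed.

Lemma big_halves (T : Type) (idx : T) (op : Monoid.com_law idx) (f : nat -> T) N :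
  \big[op/idx]_(i < N) f i =
  op (\big[op/idx]_(i < uphalf N) f (2 * i)%N) (\big[op/idx]_(i < N./2) f (2 * i).+1).
Proof.
elim: N => [|N IH]; first by rewrite !big_ord0 Monoid.mul1m.
rewrite big_ord_recr/= {}IH -(odd_double_half N); move: (N./2) => k.
case: (odd N); rewrite ?add1n ?add0n /= ?doubleK ?uphalf_double.
  by rewrite [X in _ = op _ X]big_ord_recr/= mul2n Monoid.mulmA.
by rewrite big_ord_recr/= mul2n Monoid.mulmAC.
Qed.

Section density.
Context {R : realType}.

(** A relation rather than a value: [lim] returns a default when there is no limit, so existence has
    to be carried along with the value. *)
Definition has_density (f : nat -> bool) (l : R) :=
  ((\sum_(i < N) f i)%:R / N%:R : R) @[N --> \oo] --> l.

Lemma cvg_half : N./2 @[N --> \oo] --> \oo.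
Proof.
move=> /= A [M _ MA]; exists M.*2 => // n /= Mn; apply: MA => /=.
by have := half_leq Mn; rewrite doubleK.
Qed.

Lemma cvg_uphalf : uphalf N @[N --> \oo] --> \oo.
Proof.
move=> /= A [M _ MA]; exists M.*2 => // n /= Mn; apply: MA => /=.
by have := half_leq (leqW Mn); rewrite doubleK.
Qed.

Lemma cvg_half_ratio : (N./2%:R / N%:R : R) @[N --> \oo] --> (2^-1 : R).
Proof.
apply/cvgrPdist_le => /= e e0.
have : (n.+1%:R^-1 : R) @[n --> \oo] --> (0 : R) by exact: cvg_harmonic.
rewrite (cvg_shiftS (fun n => n%:R^-1 : R)) => /cvgrPdist_le/(_ _ e0).
apply: filterS2 (nbhs_infty_gt 0) => n n0; rewrite sub0r normrN.
apply: le_trans; have x0 : (0 : R) < n%:R by rewrite ltr0n.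
have h : (odd n)%:R + 2 * n./2%:R = n%:R :> R.
  by rewrite -natrM mul2n -natrD odd_double_half.
have -> : 2^-1 - n./2%:R / n%:R = (odd n)%:R / 2 / n%:R :> R.
  have -> : (odd n)%:R = n%:R - 2 * n./2%:R :> R by rewrite -h addrK.
  by field; rewrite gt_eqF.
rewrite ger0_norm ?divr_ge0 ?ler0n// ger0_norm ?invr_ge0 ?ler0n//.
rewrite -[leRHS]mul1r ler_wpM2r ?invr_ge0 ?ler0n//.
by case: (odd n); rewrite ?mul0r//= mul1r invf_le1 ?ler1n.
Qed.

Lemma cvg_uphalf_ratio : ((uphalf N)%:R / N%:R : R) @[N --> \oo] --> (2^-1 : R).
Proof.
have h : 1 - (N./2%:R / N%:R : R) @[N --> \oo] --> (2^-1 : R).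
  rewrite [X in _ --> X](_ : 2^-1 = 1 - 2^-1 :> R); last by field.
  by apply: cvgB; [exact: cvg_cst|exact: cvg_half_ratio].
apply: cvg_trans h; apply: near_eq_cvg.
near=> n; have n0 : (0 < n)%N by near: n; exact: nbhs_infty_gt.
have x0 : (n%:R : R) != 0 by rewrite pnatr_eq0 -lt0n.
have -> : (uphalf n)%:R = n%:R - n./2%:R :> R.
  by rewrite -{2}(odd_double_half n) -addnn addnA -uphalf_half natrD addrK.
by rewrite mulrBl divff.
Unshelve. all: by end_near.
Qed.

Lemma has_density_halves f l0 l1 :
  has_density (fun n => f (2 * n)%N) l0 -> has_density (fun n => f (2 * n).+1) l1 ->
  has_density f ((l0 + l1) / 2).
Proof.
move=> h0 h1; rewrite /has_density.
under eq_cvg => N do rewrite (big_halves _ (fun n => nat_of_bool (f n))) natrD mulrDl.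
(* The condition [g 0%N = 0] covers the indices with [u N = 0], where division by [(u N)%:R] gives
   0. *)
have sim (g : nat -> R) (u : nat -> nat) (l : R) : g n / n%:R @[n --> \oo] --> l ->
    g 0%N = 0 -> u N @[N --> \oo] --> \oo -> ((u N)%:R / N%:R : R) @[N --> \oo] --> (2^-1 : R) ->
    g (u N) / N%:R @[N --> \oo] --> l / 2.
  move=> gl g0 uoo u2.
  have -> : (fun N => g (u N) / N%:R) =
      (fun N => (g (u N) / (u N)%:R) * ((u N)%:R / N%:R)).
    apply/funext => n; have [->|n0] := eqVneq (u n) 0%N; first by rewrite g0 !mul0r.
    by rewrite mulrA divfK// pnatr_eq0.
  by apply: cvgM => //; exact: (cvg_comp _ _ uoo gl).
rewrite mulrDl; apply: cvgD.
- apply: (sim (fun n => (\sum_(i < n) f (2 * i)%N)%:R)) => //.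
  + by rewrite big_ord0.
  + exact: cvg_uphalf.
  + exact: cvg_uphalf_ratio.
- apply: (sim (fun n => (\sum_(i < n) f (2 * i).+1)%:R)) => //.
  + by rewrite big_ord0.
  + exact: cvg_half.
  + exact: cvg_half_ratio.
Qed.

Lemma has_density_cst (b : bool) : has_density (fun=> b) b%:R.
Proof.
rewrite /has_density; apply: cvg_near_cst; near=> n.
have n0 : (0 < n)%N by near: n; exact: nbhs_infty_gt.
by rewrite sum_nat_const card_ord natrM mulrAC divff ?mul1r// pnatr_eq0 -lt0n.
Unshelve. all: by end_near.
Qed.

Definition digit_diff a d n := ((s2 (n + a))%:Z - (s2 n)%:Z == d).

Lemma mu_density a d l :
  has_density (digit_diff a d) l -> mu a d = l :> R.
Proof.
move=> h; rewrite /mu; apply/cvg_lim => //.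
rewrite (_ : (fun N => _) = (fun N =>
    (\sum_(i < N) digit_diff a d i)%:R / N%:R)) //.
by apply/funext => n; rewrite -sum1_card [in LHS]big_mkcond.
Qed.

(** Adding an even number leaves the last digit of n alone and produces no carry out of it. *)
Lemma has_density_double a d l : has_density (digit_diff a d) l ->
  has_density (digit_diff (2 * a) d) l.
Proof.
move=> h; have -> : l = (l + l) / 2 by field.
apply: has_density_halves.
- by under eq_fun do rewrite /digit_diff -mulnDr !s2_double.
- rewrite (_ : (fun n => _) = digit_diff a d) //; apply/funext => n.
  by rewrite /digit_diff addSn -mulnDr !s2_doubleS; congr (_ == _); lia.
Qed.

(** For n even the last digit becomes 1 without carry, a gain of 1; for n odd it becomes 0 and the
    carry turns a into a+1. *)
Lemma has_density_doubleS a d l0 l1 : has_density (digit_diff a (d - 1)) l0 ->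
  has_density (digit_diff a.+1 (d + 1)) l1 ->
  has_density (digit_diff (2 * a).+1 d) ((l0 + l1) / 2).
Proof.
move=> h0 h1; apply: has_density_halves.
- rewrite (_ : (fun n => _) = digit_diff a (d - 1)) //; apply/funext => n.
  by rewrite /digit_diff addnS -mulnDr s2_doubleS s2_double; lia.
- rewrite (_ : (fun n => _) = digit_diff a.+1 (d + 1)) //; apply/funext => n.
  rewrite /digit_diff (_ : (2 * n).+1 + (2 * a).+1 = 2 * (n + a.+1))%N; last by lia.
  by rewrite s2_doubleS s2_double; lia.
Qed.

Lemma digit_diff0 d : digit_diff 0 d = fun=> d == 0.
Proof. by apply/funext => n; rewrite /digit_diff addn0 subrr eq_sym. Qed.

(** Since 1 = 2 * 0 + 1, the recursion at 1 calls [mu 1] again, at d + 1. The induction is thus on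
    d, downwards from the values d >= 2, which are never attained. *)
Lemma has_density_one d : exists l, has_density (digit_diff 1 d) l.
Proof.
have big e : 2 <= e -> exists l, has_density (digit_diff 1 e) l.
  move=> e2; exists 0.
  have -> : digit_diff 1 e = fun=> false; last exact: has_density_cst false.
  apply/funext => n; apply/negP => /eqP h; have := s2S_le n; rewrite -addn1; lia.
have [d2|d2] := leP 2 d; first exact: big.
have -> : d = 2 - `|2 - d|%N%:Z by lia.
elim: `|2 - d|%N => [|j [l IH]]; first exact: big.
exists (((2 - j.+1%:Z - 1 == 0)%:R + l) / 2).
apply: (@has_density_doubleS 0).
  by rewrite digit_diff0; exact: has_density_cst.
by have -> : 2 - j.+1%:Z + 1 = 2 - j%:Z by lia.
Qed.

Lemma mu_exists a d : has_density (digit_diff a d) (mu a d).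
Proof.
suff [l h] : exists l, has_density (digit_diff a d) l by rewrite (mu_density h).
elim/ltn_ind: a d => a IH d.
have [->|a0] := eqVneq a 0%N.
  by exists (d == 0)%:R; rewrite digit_diff0; exact: has_density_cst.
(* From here on a >= 2, so [a./2.+1] is smaller than a when a is odd. *)
have [->|a1] := eqVneq a 1%N; first exact: has_density_one.
have := odd_double_half a; rewrite -mul2n; case: (odd a) => ae.
  have [l0 h0] := IH a./2 ltac:(lia) (d - 1).
  have [l1 h1] := IH a./2.+1 ltac:(lia) (d + 1).
  by exists ((l0 + l1) / 2); rewrite -ae add1n; exact: has_density_doubleS.
have [l h] := IH a./2 ltac:(lia) d.
by exists l; rewrite -ae add0n; exact: has_density_double.
Qed.

Lemma mu0 d : mu 0 d = (d == 0)%:R :> R.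
Proof. by apply: mu_density; rewrite digit_diff0; exact: has_density_cst. Qed.

Lemma mu_double a d : mu (2 * a) d = mu a d :> R.
Proof. by apply: mu_density; apply: has_density_double; exact: mu_exists. Qed.

Lemma mu_doubleS a d : mu (2 * a).+1 d = (mu a (d - 1) + mu a.+1 (d + 1)) / 2 :> R.
Proof. by apply: mu_density; apply: has_density_doubleS; exact: mu_exists. Qed.

Lemma mu1_ge2 d : 2 <= d -> mu 1 d = 0 :> R.
Proof.
move=> d2; apply: mu_density; rewrite (_ : digit_diff 1 d = fun=> false).
  exact: has_density_cst false.
by apply/funext => n; apply/negP => /eqP h; have := s2S_le n; rewrite -addn1; lia.
Qed.
End density.

(** * Finiteness and recursion of the moments *)

Section signed_sum.
Context {R : realType} {T : choiceType}.
Implicit Types f g h : T -> R.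

Definition abs_summable f := summable [set: T] (fun x => (f x)%:E).

Definition signed_esum f : \bar R :=
  (\esum_(d in [set: T]) ((fun x => (f x)%:E)^\+ d)
   - \esum_(d in [set: T]) ((fun x => (f x)%:E)^\- d))%E.

Definition signed_sum f : R := fine (signed_esum f).

Lemma abs_summableD f g : abs_summable f -> abs_summable g ->
  abs_summable (fun x => f x + g x).
Proof. exact: summableD. Qed.

Lemma abs_summableN f : abs_summable f -> abs_summable (fun x => - f x).
Proof.
move=> sf; rewrite /abs_summable; under [X in summable _ X]eq_fun do rewrite EFinN.
by rewrite -summableN.
Qed.

Lemma abs_summable0 : abs_summable (fun=> 0).
Proof. by rewrite /abs_summable /summable esum1// => x _; rewrite abse0. Qed.

Lemma abs_summable_le f g : (forall x, `|f x| <= `|g x|) -> abs_summable g -> abs_summable f.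
Proof.
move=> fg; apply: le_lt_trans; apply: le_esum => x _.
by rewrite lee_fin.
Qed.

Lemma abs_summable_sum (n : nat) (F : nat -> T -> R) :
  (forall i, (i < n)%N -> abs_summable (F i)) -> abs_summable (fun x => \sum_(i < n) F i x).
Proof.
elim: n => [|n IH] sF.
  by under [X in abs_summable X]eq_fun do rewrite big_ord0; exact: abs_summable0.
under [X in abs_summable X]eq_fun do rewrite big_ord_recr/=.
apply: abs_summableD; last exact: sF.
  by apply: IH => i li; apply: sF; exact: ltnW.
Qed.

Lemma abs_summableMn f n : abs_summable f -> abs_summable (fun x => f x *+ n).
Proof.
move=> sf; rewrite (_ : (fun x => _) = fun x => \sum_(i < n) f x); last first.
  by apply/funext => x; rewrite sumr_const card_ord.
exact: (abs_summable_sum (F := fun=> f)).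
Qed.

(** Any splitting into nonnegative summable families gives the signed sum. Additivity rests on this
    freedom, because positive parts are not additive. *)
Lemma signed_esumB g h : (forall x, 0 <= g x) -> (forall x, 0 <= h x) ->
  abs_summable g -> abs_summable h ->
  signed_esum (fun x => g x - h x) =
  (\esum_(x in [set: T]) (g x)%:E - \esum_(x in [set: T]) (h x)%:E)%E.
Proof.
move=> g0 h0 sg sh; rewrite -esumB//.
by move=> i _; rewrite lee_fin.
by move=> i _; rewrite lee_fin.
Qed.

Lemma esum_fin f : (forall x, 0 <= f x) -> abs_summable f ->
  \esum_(x in [set: T]) (f x)%:E \is a fin_num.
Proof.
move=> f0; rewrite /abs_summable summableE; congr (_ \is a fin_num).
by apply: eq_esum => x _; rewrite /= ger0_norm.
Qed.

Definition pos_part f x := Num.max (f x) 0.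

Lemma pos_part_ge0 f x : 0 <= pos_part f x.
Proof. by rewrite /pos_part le_max lexx orbT. Qed.

Lemma pos_partB f x : f x = pos_part f x - pos_part (fun y => - f y) x.
Proof.
rewrite /pos_part; have [h|h] := leP (f x) 0; have [h'|h'] := leP (- f x) 0; lra.
Qed.

Lemma abs_summable_pos f : abs_summable f -> abs_summable (pos_part f).
Proof.
apply: abs_summable_le => x; rewrite /pos_part.
by have [h|h] := leP (f x) 0; rewrite ?normr0.
Qed.

Lemma signed_esum_pos f : abs_summable f -> signed_esum f =
  (\esum_(x in [set: T]) (pos_part f x)%:E
   - \esum_(x in [set: T]) (pos_part (fun y => - f y) x)%:E)%E.
Proof.
move=> sf; rewrite -signed_esumB//; try exact: pos_part_ge0; try exact: abs_summable_pos.
  by congr signed_esum; apply/funext => x; exact: pos_partB.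
by apply: abs_summable_pos; exact: abs_summableN.
Qed.

Lemma signed_esumE f : abs_summable f -> signed_esum f = (signed_sum f)%:E.
Proof.
move=> sf; rewrite /signed_sum fineK// signed_esum_pos// fin_numB.
by rewrite !esum_fin//; try exact: pos_part_ge0; apply: abs_summable_pos => //; exact: abs_summableN.
Qed.

Lemma signed_sumD f g : abs_summable f -> abs_summable g ->
  signed_sum (fun x => f x + g x) = signed_sum f + signed_sum g.
Proof.
move=> sf sg; apply: EFin_inj; rewrite EFinD -!signed_esumE//; last exact: abs_summableD.
rewrite (signed_esum_pos sf) (signed_esum_pos sg).
have snf := abs_summableN sf; have sng := abs_summableN sg.
have -> : (fun x => f x + g x) = (fun x => (pos_part f x + pos_part g x) -
   (pos_part (fun y => - f y) x + pos_part (fun y => - g y) x)).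
  by apply/funext => x; rewrite {1}(pos_partB f x) {1}(pos_partB g x); lra.
rewrite signed_esumB; first last.
- by apply: abs_summableD; exact: abs_summable_pos.
- by apply: abs_summableD; exact: abs_summable_pos.
- by move=> x; rewrite addr_ge0 ?pos_part_ge0.
- by move=> x; rewrite addr_ge0 ?pos_part_ge0.
under eq_esum do rewrite EFinD.
rewrite esumD; try by move=> x _; rewrite lee_fin pos_part_ge0.
under [X in (_ - X)%E]eq_esum do rewrite EFinD.
rewrite esumD; try by move=> x _; rewrite lee_fin pos_part_ge0.
rewrite fin_num_oppeD ?esum_fin//; try exact: pos_part_ge0; try exact: abs_summable_pos.
by rewrite addeACA.
Qed.

Lemma signed_sum0 : signed_sum (fun=> 0) = 0.
Proof.
have := signed_sumD abs_summable0 abs_summable0.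
under eq_fun do rewrite addr0.
lra.
Qed.

Lemma signed_sumN f : abs_summable f -> signed_sum (fun x => - f x) = - signed_sum f.
Proof.
move=> sf; have := signed_sumD sf (abs_summableN sf).
under eq_fun do rewrite subrr; rewrite signed_sum0; lra.
Qed.

Lemma signed_sum_sum (n : nat) (F : nat -> T -> R) :
  (forall i, (i < n)%N -> abs_summable (F i)) ->
  signed_sum (fun x => \sum_(i < n) F i x) = \sum_(i < n) signed_sum (F i).
Proof.
elim: n => [|n IH] sF.
  by rewrite big_ord0; under eq_fun do rewrite big_ord0; exact: signed_sum0.
rewrite big_ord_recr -IH/=; last by move=> i ?; apply: sF; exact: ltnW.
rewrite -signed_sumD; last 2 first.
- by apply: abs_summable_sum => i ?; apply: sF; exact: ltnW.
- exact: sF.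
by congr signed_sum; apply/funext => x; rewrite big_ord_recr.
Qed.

Lemma signed_sumMn f n : abs_summable f -> signed_sum (fun x => f x *+ n) = signed_sum f *+ n.
Proof.
move=> sf; rewrite (_ : (fun x => _) = fun x => \sum_(i < n) f x).
  by rewrite (signed_sum_sum (F := fun=> f))// sumr_const card_ord.
by apply/funext => x; rewrite sumr_const card_ord.
Qed.

Lemma abs_summable_bij f (e : T -> T) : bijective e ->
  abs_summable f -> abs_summable (f \o e).
Proof.
move=> be; rewrite /abs_summable /summable (reindex_esum setT setT e)//.
by rewrite setTT_bijective.
Qed.

Lemma signed_sum_bij f (e : T -> T) : bijective e ->
  signed_sum (f \o e) = signed_sum f.
Proof.
move=> be; have se : set_bij [set: T] [set: T] e by rewrite setTT_bijective.
rewrite /signed_sum /signed_esum; congr (fine (_ - _)%E);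
  rewrite [RHS](reindex_esum setT setT e)//; apply: eq_esum => d _;
  by rewrite ?funeposE ?funenegE.
Qed.
End signed_sum.

Section moment_recursion.
Context {R : realType}.
Local Notation mu := (@mu R).
Local Notation summand k a := (fun d : int => mu a d * d%:~R ^+ k).

Lemma bijective_addz (c : int) : bijective (fun d : int => d + c).
Proof. by exists (fun d => d - c) => d; rewrite ?addrK ?subrK. Qed.

Definition has_moments (f : int -> R) := forall k, abs_summable (fun d => f d * d%:~R ^+ k).

(* A change of variable moves the translation from the weight to the power. *)
Lemma translate_expand (f : int -> R) (c : int) k :
  (fun d : int => f (d + c) * d%:~R ^+ k) =
  (fun d => \sum_(i < k.+1) (f d * d%:~R ^+ (k - i) * (- c%:~R) ^+ i) *+ 'C(k, i)) \o
    (fun d => d + c).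
Proof.
apply/funext => d /=.
have -> : d%:~R = (d + c)%:~R - c%:~R :> R by rewrite intrD addrK.
rewrite exprDn mulr_sumr; apply: eq_bigr => i _.
by rewrite mulrnAr mulrA.
Qed.

(** Only translations by 1 and -1 occur, so every coefficient is a sign times a natural number, and
    additivity and negation of signed sums suffice. *)
Lemma signr_eq1 (c : int) i : `|c| = 1 -> (- c%:~R : R) ^+ i = 1 \/ (- c%:~R : R) ^+ i = -1.
Proof.
move=> c1; have [->|->] : c = 1 \/ c = -1 by lia.
  by rewrite -signr_odd; case: (odd i); [right|left]; rewrite ?expr0 ?expr1.
by rewrite mulrN1z opprK expr1n; left.
Qed.

Lemma translate_term_summable (f : int -> R) (c : int) k i : `|c| = 1 -> has_moments f ->
  abs_summable (fun d : int => (f d * d%:~R ^+ k * (- c%:~R) ^+ i)).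
Proof.
move=> /(signr_eq1 i)[->|->] mf.
  by under [X in abs_summable X]eq_fun do rewrite mulr1; exact: mf.
under [X in abs_summable X]eq_fun do rewrite mulrN1; exact: abs_summableN (mf k).
Qed.

Lemma has_moments_translate (f : int -> R) (c : int) : `|c| = 1 -> has_moments f ->
  has_moments (fun d => f (d + c)).
Proof.
move=> c1 mf k; rewrite translate_expand.
apply: abs_summable_bij; first exact: bijective_addz.
apply: (abs_summable_sum (F := fun i d => (f d * d%:~R ^+ (k - i) * (- c%:~R) ^+ i) *+ 'C(k, i))).
by move=> i _; apply: abs_summableMn; exact: translate_term_summable.
Qed.

Lemma signed_sum_translate (f : int -> R) (c : int) k : `|c| = 1 -> has_moments f ->
  signed_sum (fun d : int => f (d + c) * d%:~R ^+ k) =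
  \sum_(i < k.+1) (signed_sum (fun d : int => f d * d%:~R ^+ (k - i)) * (- c%:~R) ^+ i) *+ 'C(k, i).
Proof.
move=> c1 mf; rewrite translate_expand signed_sum_bij; last exact: bijective_addz.
rewrite (signed_sum_sum (F := fun i d => (f d * d%:~R ^+ (k - i) * (- c%:~R) ^+ i) *+ 'C(k, i))); last first.
  by move=> i _; apply: abs_summableMn; exact: translate_term_summable.
apply: eq_bigr => i _; rewrite signed_sumMn; last exact: translate_term_summable.
congr (_ *+ _); have [->|->] := signr_eq1 i c1.
  by rewrite mulr1; under eq_fun do rewrite mulr1.
by rewrite mulrN1; under eq_fun do rewrite mulrN1; rewrite signed_sumN.
Qed.

Lemma has_moments0 : has_moments (mu 0).
Proof.
move=> k; apply: le_lt_trans (ltry `|(0 ^+ k : R)|).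
rewrite (esumID [set 0])//= [X in (_ + X)%E]esum1 ?adde0.
  rewrite setTI esum_set1//= mu0 eqxx mul1r; exact: lexx.
by move=> d /= [_ /eqP/negbTE d0]; rewrite mu0 d0 mul0r normr0.
Qed.

(** Adding 1 to n changes the digit sum by 1 - j when n ends in exactly j ones, which has density
    2^-(j+1). *)
Lemma mu1_tail j : mu 1 (1 - j%:Z) = 2^-1 * 2^-1 ^+ j.
Proof.
elim: j => [|j IH].
  rewrite subr0 expr0 -[X in mu X _]/((2 * 0).+1) mu_doubleS mu0 mu1_ge2//.
  by rewrite subrr eqxx addr0 mul1r mulr1.
rewrite -[X in mu X _]/((2 * 0).+1) mu_doubleS mu0.
have -> : 1 - j.+1%:Z + 1 = 1 - j%:Z by lia.
have -> : (1 - j.+1%:Z - 1 == 0) = false by lia.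
by rewrite add0r IH mulrC exprS.
Qed.

(** Induction on k with r replaced by its square root: one factor sqrt(r)^j absorbs the first k
    powers, the other the last one. *)
Lemma power_le_exponential (r : R) k : 1 < r ->
  exists2 C, 0 <= C & forall j : nat, j.+1%:R ^+ k <= C * r ^+ j.
Proof.
elim: k r => [|k IH] r r1.
  by exists 1 => // j; rewrite expr0 mul1r exprn_ege1// ltW.
have s1 : 1 < Num.sqrt r by rewrite -sqrtr1 ltr_sqrt// (lt_trans ltr01).
have r0 : 0 <= r by rewrite ltW// (lt_trans ltr01).
have [C C0 HC] := IH _ s1.
(* Each increment of the right side is (1+t)^(j+1) >= 1, where t = sqrt(r) - 1. *)
have B j : j.+1%:R <= (1 + (Num.sqrt r - 1)^-1) * Num.sqrt r ^+ j.
  set t := Num.sqrt r - 1; have t0 : 0 < t by rewrite subr_gt0.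
  have -> : Num.sqrt r = 1 + t by rewrite addrC subrK.
  elim: j => [|j IHj]; first by rewrite expr0 mulr1 lerDl invr_ge0 ltW.
  have q1 : 1 <= (1 + t) ^+ j by rewrite exprn_ege1// lerDl ltW.
  have -> : (1 + t^-1) * (1 + t) ^+ j.+1 = (1 + t^-1) * (1 + t) ^+ j + (1 + t) * (1 + t) ^+ j.
    by rewrite exprSr; field; rewrite gt_eqF.
  rewrite -natr1 lerD//; nra.
exists (C * (1 + (Num.sqrt r - 1)^-1)).
  by rewrite mulr_ge0// addr_ge0// invr_ge0 subr_ge0 ltW.
move=> j; have -> : r ^+ j = Num.sqrt r ^+ j * Num.sqrt r ^+ j.
  by rewrite -expr2 -exprM mulnC exprM sqr_sqrtr.
by rewrite exprSr mulrACA; apply: ler_pM; rewrite ?exprn_ge0.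
Qed.

Lemma has_moments1 : has_moments (mu 1).
Proof.
move=> k; rewrite /abs_summable /summable.
(* Any ratio strictly between 1 and 2 would do: against the weights 2^-(j+1) it leaves a convergent
   geometric series, here of ratio 3/4. *)
have [|C C0 HC] := @power_le_exponential (3 / 2) k; first by rewrite ltr_pdivlMr ?mul1r ?ltr_nat.
pose e (j : nat) : int := 1 - j%:Z.
have ie : set_inj [set: nat] e by move=> i j _ _; rewrite /e => h; lia.
rewrite (esumID (e @` [set: nat]))//= [X in (_ + X)%E]esum1 ?adde0; last first.
  move=> d /= [_ nd]; rewrite mu1_ge2 ?mul0r ?normr0// leNgt; apply/negP => d2.
  by apply: nd; exists `|1 - d|%N => //; rewrite /e; lia.
rewrite setTI esum_image// -nneseries_esumT//.
pose g := geometric (C / 2) (3 / 4 : R).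
have le j : (`|mu 1 (e j) * (e j)%:~R ^+ k|%:E <= (g j)%:E)%E.
  rewrite lee_fin mu1_tail normrM ger0_norm; last by rewrite mulr_ge0 ?exprn_ge0.
  rewrite normrX /g /= -mulrA [C * _]mulrC -mulrA ler_wpM2l//.
  have -> : 3 / 4 = 2^-1 * (3 / 2) :> R by field.
  rewrite exprMn mulrCA ler_wpM2l ?exprn_ge0// (le_trans _ (HC j))//.
  rewrite lerXn2r ?nnegrE// -intr_norm -[j.+1%:R]/(j.+1%:~R) ler_int /e; lia.
apply: (@le_lt_trans _ _ ((C / 2 / (1 - 3 / 4))%:E)); last exact: ltry.
apply: (le_trans (lee_nneseries _ (fun j _ => le j))) => //.
apply: lime_le; first by apply: is_cvg_nneseries => n _ _; rewrite lee_fin mulr_ge0 ?exprn_ge0// divr_ge0.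
apply: nearW => n; rewrite sumEFin lee_fin.
apply: geometric_le_lim; rewrite ?divr_ge0//.
by rewrite ger0_norm ?divr_ge0// ltr_pdivrMr ?mul1r ?ltr_nat.
Qed.

Lemma has_moments_mu a : has_moments (mu a).
Proof.
elim/ltn_ind: a => a IH.
have [->|a0] := eqVneq a 0%N; first exact: has_moments0.
have [->|a1] := eqVneq a 1%N; first exact: has_moments1.
have := odd_double_half a; rewrite -mul2n; case: (odd a) => ae; last first.
  rewrite -ae add0n => k; under [X in abs_summable X]eq_fun do rewrite mu_double.
  by apply: IH; lia.
rewrite -ae add1n => k; under [X in abs_summable X]eq_fun do rewrite mu_doubleS.
have h0 := @has_moments_translate _ (-1) erefl (IH a./2 ltac:(lia)) k.
have h1 := @has_moments_translate _ 1 erefl (IH a./2.+1 ltac:(lia)) k.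
apply: abs_summable_le (abs_summableD h0 h1) => d /=.
rewrite -mulrDl !normrM ler_wpM2r// ler_piMr//.
by rewrite ger0_norm ?invr_ge0// invf_le1 ?ler1n.
Qed.

Definition mom k a : R := signed_sum (summand k a).

Lemma momentE k a : moment k a = (mom k a)%:E.
Proof. by rewrite -signed_esumE//; exact: has_moments_mu. Qed.

Lemma mom_0 k : mom k 0 = (k == 0)%:R.
Proof.
rewrite /mom /signed_sum signed_esum_pos; last exact: has_moments_mu.
have p d : pos_part (summand k 0) d = if d == 0 then (k == 0)%:R else 0.
  rewrite /pos_part mu0; have [->|_] := eqVneq d 0; last by rewrite mul0r maxxx.
  by rewrite mul1r expr0n max_l.
have n d : pos_part (fun y => - summand k 0 y) d = 0.
  rewrite /pos_part mu0; have [->|_] := eqVneq d 0; last by rewrite mul0r oppr0 maxxx.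
  by rewrite mul1r expr0n max_r// oppr_le0.
under eq_esum do rewrite p.
under [X in (_ - X)%E]eq_esum do rewrite n.
rewrite [X in (_ - X)%E]esum1// sube0 (esumID [set 0])/=; last by move=> d _; case: ifP.
rewrite setTI esum_set1 ?eqxx// [X in (_ + X)%E]esum1 ?adde0// => d [_ /eqP/negbTE ->] //.
Qed.

Lemma mom_double k a : mom k (2 * a) = mom k a.
Proof. by rewrite /mom; under eq_fun do rewrite mu_double. Qed.

Lemma mom_doubleS k a : mom k (2 * a).+1 =
  (\sum_(i < k.+1) (mom (k - i) a + (-1) ^+ i * mom (k - i) a.+1) *+ 'C(k, i)) / 2.
Proof.
have h0 := @has_moments_translate _ (-1) erefl (@has_moments_mu a) k.
have h1 := @has_moments_translate _ 1 erefl (@has_moments_mu a.+1) k.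
have half : abs_summable (summand k (2 * a).+1) by exact: has_moments_mu.
(* The identity is doubled to avoid the factor 1/2, so that additivity is enough. *)
have : mom k (2 * a).+1 + mom k (2 * a).+1 =
    signed_sum (fun d : int => mu a (d - 1) * d%:~R ^+ k) +
    signed_sum (fun d : int => mu a.+1 (d + 1) * d%:~R ^+ k).
  rewrite -!signed_sumD//; congr signed_sum; apply/funext => d.
  by rewrite mu_doubleS; field.
rewrite !signed_sum_translate//; try exact: has_moments_mu.
rewrite -big_split/= => h; apply: (@mulfI _ 2) => //; rewrite mulrCA divff// mulr1.
rewrite mulr2n mulrDl mul1r h; apply: eq_bigr => i _.
by rewrite -mulrnDl mulrN1z opprK expr1n mulr1 mulrC.
Qed.
End moment_recursion.

(** * Growth in the number of binary digits *)

Section growth.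
Context {R : realType}.
Implicit Types f g h : nat -> R.

(** Half-integer powers of the length become natural powers of this root; the shift by 1 keeps it at
    least 1, so the bounds are monotone in the exponent. *)
Definition root_length (n : nat) : R := Num.sqrt n.+1%:R.

(** The condition a < 2^n allows leading zeros: n is any upper bound for the number of digits. *)
Definition digitO (e : nat) f := exists2 C, 0 <= C &
  forall n a, (a < 2 ^ n)%N -> `|f a| <= C * root_length n ^+ e.

Lemma root_length_ge1 n : 1 <= root_length n.
Proof. by rewrite -sqrtr1 ler_sqrt ?ler1n// ltr0n. Qed.

Lemma root_lengthX_ge1 n e : 1 <= root_length n ^+ e.
Proof. by rewrite exprn_ege1// root_length_ge1. Qed.

Lemma root_length_le n : root_length n <= root_length n.+1.
Proof. by rewrite ler_sqrt ?ltr0n// ler_nat. Qed.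

Lemma root_lengthX_ge0 n e : 0 <= root_length n ^+ e.
Proof. by rewrite exprn_ge0// sqrtr_ge0. Qed.

Lemma eq_digitO e f g : f =1 g -> digitO e f -> digitO e g.
Proof. by move=> /funext ->. Qed.

Lemma digitO_weak e e' f : (e <= e')%N -> digitO e f -> digitO e' f.
Proof.
move=> ee' [C C0 HC]; exists C => // n a an; apply: (le_trans (HC n a an)).
by rewrite ler_wpM2l// ler_weXn2l// root_length_ge1.
Qed.

Lemma digitO_cst e (c : R) : digitO e (fun=> c).
Proof.
exists `|c| => // n a _; rewrite -[leLHS]mulr1 ler_wpM2l//.
exact: root_lengthX_ge1.
Qed.

Lemma digitOD e f g : digitO e f -> digitO e g -> digitO e (fun a => f a + g a).
Proof.
move=> [C C0 HC] [C' C'0 HC']; exists (C + C'); first exact: addr_ge0.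
move=> n a an; rewrite (le_trans (ler_normD _ _))// mulrDl lerD//; [exact: HC|exact: HC'].
Qed.

Lemma digitOM e e' f g : digitO e f -> digitO e' g -> digitO (e + e') (fun a => f a * g a).
Proof.
move=> [C C0 HC] [C' C'0 HC']; exists (C * C'); first exact: mulr_ge0.
by move=> n a an; rewrite normrM exprD mulrACA ler_pM//; [exact: HC|exact: HC'].
Qed.

Lemma digitOZ e c f : digitO e f -> digitO e (fun a => c * f a).
Proof. by move=> Of; rewrite -[e]add0n; apply: digitOM => //; exact: digitO_cst. Qed.

Lemma digitON e f : digitO e f -> digitO e (fun a => - f a).
Proof. by move=> Of; apply: eq_digitO (digitOZ (-1) Of) => a; rewrite mulN1r. Qed.

Lemma digitOB e f g : digitO e f -> digitO e g -> digitO e (fun a => f a - g a).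
Proof. by move=> Of Og; apply: digitOD => //; exact: digitON. Qed.

Lemma digitOX e f p : digitO e f -> digitO (e * p) (fun a => f a ^+ p).
Proof.
move=> Of; elim: p => [|p IH].
  by rewrite muln0; exact: digitO_cst.
by rewrite mulnS; under [X in digitO _ X]eq_fun do rewrite exprS; exact: digitOM.
Qed.

Lemma digitO_sum e (n : nat) (F : nat -> nat -> R) : (forall i, (i < n)%N -> digitO e (F i)) ->
  digitO e (fun a => \sum_(i < n) F i a).
Proof.
elim: n => [|n IH] OF.
  by under [X in digitO _ X]eq_fun do rewrite big_ord0; exact: digitO_cst.
under [X in digitO _ X]eq_fun do rewrite big_ord_recr/=.
by apply: digitOD; [apply: IH => i li; apply: OF; exact: ltnW|exact: OF].
Qed.

Lemma half_lt_pow a n : (a < 2 ^ n.+1)%N -> (a./2 < 2 ^ n)%N.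
Proof. by rewrite expnS; lia. Qed.

Lemma digitO_digit e f (c : R) :
  digitO e (fun a => f (2 * a)%N - c * f a) -> digitO e (fun a => f (2 * a).+1 - c * f a) ->
  exists2 C, 0 <= C &
    forall n a, (a < 2 ^ n.+1)%N -> `|f a - c * f a./2| <= C * root_length n ^+ e.
Proof.
move=> [C0 C00 H0] [C1 C10 H1]; exists (C0 + C1); first exact: addr_ge0.
move=> n a /half_lt_pow an; have h0 := H0 _ _ an; have h1 := H1 _ _ an.
have h0' : 0 <= C0 * root_length n ^+ e by rewrite mulr_ge0 ?root_lengthX_ge0.
have h1' : 0 <= C1 * root_length n ^+ e by rewrite mulr_ge0 ?root_lengthX_ge0.
have := odd_double_half a; rewrite -mul2n mulrDl; case: (odd a) => ae.
  by rewrite -{1}ae add1n (le_trans h1)// lerDr.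
by rewrite -{1}ae add0n (le_trans h0)// lerDl.
Qed.

(* The errors of successive digits add up as a geometric series. *)
Lemma digitO_halving e f :
  digitO e (fun a => f (2 * a)%N - 2^-1 * f a) ->
  digitO e (fun a => f (2 * a).+1 - 2^-1 * f a) -> digitO e f.
Proof.
move=> H0 H1; have [C C0 HC] := digitO_digit H0 H1.
(* M = 2C is the fixed point of M -> M/2 + C, and [|f 0|] covers the integer without digits. *)
exists (`|f 0%N| + 2 * C); first by rewrite addr_ge0// mulr_ge0.
elim=> [|n IH] a an.
  move: an; rewrite expn0 ltnS leqn0 => /eqP ->; rewrite -[leLHS]mulr1 ler_pM//.
    by rewrite lerDl mulr_ge0.
  exact: root_lengthX_ge1.
have {}IH := IH _ (half_lt_pow an); have {}HC := HC _ _ an.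
have LL : root_length n ^+ e <= root_length n.+1 ^+ e.
  by rewrite lerXn2r ?nnegrE ?sqrtr_ge0// root_length_le.
have L0 := root_lengthX_ge0 n e; have f0 := normr_ge0 (f 0%N).
rewrite -(subrK (2^-1 * f a./2) (f a)) (le_trans (ler_normD _ _))//.
have -> : `|2^-1 * f a./2| = 2^-1 * `|f a./2| by rewrite normrM ger0_norm ?invr_ge0.
apply: (@le_trans _ _ ((`|f 0%N| + 2 * C) * root_length n ^+ e)); last first.
  by rewrite ler_wpM2l// addr_ge0// mulr_ge0.
nra.
Qed.

(* The n increments contribute the factor n <= root_length n ^+ 2. *)
Lemma digitO_increments e f :
  digitO e (fun a => f (2 * a)%N - f a) -> digitO e (fun a => f (2 * a).+1 - f a) ->
  digitO e.+2 f.
Proof.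
move=> H0 H1.
have [C C0 HC] : exists2 C, 0 <= C & forall n a, (a < 2 ^ n.+1)%N ->
    `|f a - 1 * f a./2| <= C * root_length n ^+ e.
  by apply: digitO_digit; [apply: eq_digitO H0 => a|apply: eq_digitO H1 => a]; rewrite mul1r.
have f0 := normr_ge0 (f 0%N).
have H n a : (a < 2 ^ n)%N -> `|f a| <= `|f 0%N| + n%:R * C * root_length n ^+ e.
  elim: n a => [|n IH] a an.
    by move: an; rewrite expn0 ltnS leqn0 => /eqP ->; rewrite !mul0r addr0.
  have {}IH := IH _ (half_lt_pow an); have {}HC := HC _ _ an.
  have LL : C * root_length n ^+ e <= C * root_length n.+1 ^+ e.
    by rewrite ler_wpM2l// lerXn2r ?nnegrE ?sqrtr_ge0// root_length_le.
  rewrite mul1r in HC.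
  have := ler_wpM2l (ler0n R n) LL.
  have := ler_normD (f a - f a./2) (f a./2); rewrite subrK -natr1 -!mulrA; lra.
exists (`|f 0%N| + C) => [|n a an]; first exact: addr_ge0.
rewrite (le_trans (H _ _ an))// -addn2 exprD sqr_sqrtr ?ler0n//.
have L1 := root_lengthX_ge1 n e; set L := root_length n ^+ e in L1 *.
have n1 : 1 <= n.+1%:R :> R by rewrite ler1n.
have nn : n%:R <= n.+1%:R :> R by rewrite ler_nat.
rewrite mulrDl lerD//; last by rewrite -mulrA mulrC [leRHS]mulrA ler_wpM2l// mulr_ge0// (le_trans ler01).
by rewrite ler_peMr// mulr_ege1.
Qed.

(** V has order n and h is bounded, so the difference loses one factor n, which is two powers of
    [root_length]; the Taylor version below loses two factors. *)
Lemma digitO_power_shift V h p : digitO 2 V -> digitO 0 h ->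
  digitO (2 * p) (fun a => (V a + h a) ^+ p.+1 - V a ^+ p.+1).
Proof.
move=> OV Oh; elim: p => [|p IH].
  by apply: eq_digitO Oh => a; rewrite !expr1 addrC addKr.
apply: (@eq_digitO _ (fun a => (V a + h a) * ((V a + h a) ^+ p.+1 - V a ^+ p.+1) + h a * V a ^+ p.+1)).
  by move=> a; rewrite !(exprS _ p.+1); ring.
rewrite mulnS; apply: digitOD; first by apply: digitOM => //; apply: digitOD => //; exact: digitO_weak Oh.
by rewrite -mulnS -[(2 * p.+1)%N]add0n; apply: digitOM => //; exact: digitOX.
Qed.

Lemma digitO_power_taylor V h p : digitO 2 V -> digitO 0 h ->
  digitO (2 * p) (fun a => (V a + h a) ^+ p.+2 - V a ^+ p.+2 - h a * (p.+2%:R * V a ^+ p.+1)).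
Proof.
move=> OV Oh; have Oh2 : digitO 0 (fun a => h a * h a) by exact: (@digitOM 0 0).
elim: p => [|p IH].
  by apply: eq_digitO Oh2 => a; ring.
apply: (@eq_digitO _ (fun a => (V a + h a) *
   ((V a + h a) ^+ p.+2 - V a ^+ p.+2 - h a * (p.+2%:R * V a ^+ p.+1)) + h a * h a * (p.+2%:R * V a ^+ p.+1))).
  by move=> a; rewrite -[p.+3%:R]natr1 !(exprS _ p.+2) !(exprS (V a) p.+1); ring.
rewrite mulnS; apply: digitOD; first by apply: digitOM => //; apply: digitOD => //; exact: digitO_weak Oh.
rewrite -mulnS -[(2 * p.+1)%N]add0n; apply: digitOM => //.
by apply: digitOZ; exact: digitOX.
Qed.

(** The double factorial (2p-1)!!. *)
Definition normal_coef p : R := (2 * p)`!%:R / (2 ^+ p * p`!%:R).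

(* the k-th moment of the centred normal law of variance v *)
Definition normal_moment k (v : R) : R :=
  if odd k then 0 else normal_coef k./2 * v ^+ k./2.

Lemma normal_moment_double p v : normal_moment (2 * p) v = normal_coef p * v ^+ p.
Proof. by rewrite /normal_moment oddM/= mul2n doubleK. Qed.

Lemma normal_moment_doubleS p v : normal_moment (2 * p).+1 v = 0.
Proof. by rewrite /normal_moment/= oddM. Qed.

Lemma normal_coef0 : normal_coef 0 = 1.
Proof. by rewrite /normal_coef muln0 fact0 expr0 mulr1 divr1. Qed.

Lemma normal_coef1 : normal_coef 1 = 1.
Proof. by rewrite /normal_coef muln1 expr1 !factS fact0 !muln1 mulr1 divff. Qed.

(** The heat equation on coefficients: differentiating v^(p+1) produces the factor p+1, and the
    recursion of moments produces the binomial. *)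
Lemma normal_coefS p : 'C(2 * p.+1, 2)%:R * normal_coef p = p.+1%:R * normal_coef p.+1.
Proof.
have H : ('C(2 * p.+1, 2)%:R : R) = p.+1%:R * (2 * p).+1%:R.
  by rewrite -natrM bin2 mulnS /= ; congr (_%:R); lia.
rewrite H /normal_coef mulnS !factS !natrM exprS.
have -> : (2 * p).+2%:R = 2 * p.+1%:R :> R by rewrite -natrM mulnS.
by field; rewrite nat1r !pnatr_eq0 expf_neq0// -lt0n fact_gt0.
Qed.

Lemma digitO_normal_moment V k : digitO 2 V -> digitO k (fun a => normal_moment k (V a)).
Proof.
move=> OV; rewrite /normal_moment; case ok: (odd k); first exact: digitO_cst.
apply: digitOZ; rewrite -{1}(odd_double_half k) ok add0n -mul2n; exact: digitOX.
Qed.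

Lemma parityP k : (exists p, k = 2 * p)%N \/ (exists p, k = (2 * p).+1)%N.
Proof.
have := odd_double_half k; rewrite -mul2n; case: (odd k) => /esym h.
  by right; exists k./2.
by left; exists k./2.
Qed.

Lemma normal_moment_shift V h k : digitO 2 V -> digitO 0 h ->
  digitO k (fun a => normal_moment k.+1 (V a + h a) - normal_moment k.+1 (V a)).
Proof.
move=> OV Oh; have [[p ->]|[p ->]] := parityP k.
  by under [X in digitO _ X]eq_fun do rewrite !normal_moment_doubleS subrr; exact: digitO_cst.
have -> : (2 * p).+2 = (2 * p.+1)%N by lia.
under [X in digitO _ X]eq_fun do rewrite !normal_moment_double -mulrBr.
by apply: digitOZ; apply: digitO_weak (digitO_power_shift p OV Oh).
Qed.

(* d/dv E[(sqrt v Z)^k] = 'C(k, 2) E[(sqrt v Z)^(k-2)], by the heat equation *)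
Lemma normal_moment_taylor V h k : digitO 2 V -> digitO 0 h ->
  digitO k (fun a => normal_moment k.+3 (V a + h a) - normal_moment k.+3 (V a)
     - h a * ('C(k.+3, 2)%:R * normal_moment k.+1 (V a))).
Proof.
move=> OV Oh; have [[p ->]|[p ->]] := parityP k.
  have -> : (2 * p).+3 = (2 * p.+1).+1 by lia.
  under [X in digitO _ X]eq_fun do rewrite !normal_moment_doubleS subrr mulr0 mulr0 subrr.
  exact: digitO_cst.
have -> : (2 * p).+4 = (2 * p.+2)%N by lia.
have -> : (2 * p).+2 = (2 * p.+1)%N by lia.
apply: (@eq_digitO _ (fun a => normal_coef p.+2 *
  ((V a + h a) ^+ p.+2 - V a ^+ p.+2 - h a * (p.+2%:R * V a ^+ p.+1)))).
  move=> a; rewrite !normal_moment_double (mulrA ('C(_, _)%:R)) normal_coefS; ring.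
by apply: digitOZ; apply: digitO_weak (digitO_power_taylor p OV Oh).
Qed.
End growth.

(** * Asymptotics of the moments *)

Section moment_asymptotics.
Context {R : realType} (mom : nat -> nat -> R).
Hypothesis mom_0 : forall k, mom k 0 = (k == 0%N)%:R.
Hypothesis mom_double : forall k a, mom k (2 * a) = mom k a.
Hypothesis mom_doubleS : forall k a, mom k (2 * a).+1 =
  (\sum_(i < k.+1) (mom (k - i) a + (-1) ^+ i * mom (k - i) a.+1) *+ 'C(k, i)) / 2.
Local Notation digitO := (@digitO R).

Definition second_moment a : R := mom 2 a.

Definition mom_step k a : R := mom k a.+1 - mom k a.

Definition mom_err k a : R := mom k a - normal_moment k (second_moment a).

(* mom_step 2 is the increment of second_moment, so the subtracted term is the
   first-order increment of normal_moment k. *)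
Definition step_err k a : R :=
  mom_step k a - mom_step 2 a * ('C(k, 2)%:R * normal_moment (k - 2) (second_moment a)).

(** At a = 1 the relation f(1) = (f(0) + f(1)) / 2 forces f(1) = f(0). Applied to the total mass and
    to the mean. *)
Lemma harmonic_cst (f : nat -> R) : (forall a, f (2 * a)%N = f a) ->
  (forall a, f (2 * a).+1 = (f a + f a.+1) / 2) -> forall a, f a = f 0%N.
Proof.
move=> f0 f1; elim/ltn_ind => a IH.
have [->//|a0] := eqVneq a 0%N.
have [->|a1] := eqVneq a 1%N; first by have := f1 0%N; rewrite muln0; lra.
have e1 : f a./2 = f 0%N by apply: IH; lia.
have := odd_double_half a; rewrite -mul2n; case oa: (odd a) => <-; last by rewrite add0n f0.
have e2 : f a./2.+1 = f 0%N by apply: IH; lia.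
by rewrite add1n f1 e1 e2; lra.
Qed.

Lemma mom_order0 a : mom 0 a = 1.
Proof.
rewrite -[1]/((0 == 0)%N%:R) -mom_0; apply: harmonic_cst => {}a; first exact: mom_double.
by rewrite mom_doubleS big_ord1 bin0 expr0 mul1r mulr1n.
Qed.

Lemma mom_order1 a : mom 1 a = 0.
Proof.
rewrite -[RHS](mom_0 1); apply: harmonic_cst => {}a; first exact: mom_double.
rewrite mom_doubleS !big_ord_recl big_ord0/= /bump/= !mom_order0 bin0 bin1 /= subn0; lra.
Qed.

Lemma variance_doubleS a : second_moment (2 * a).+1 = second_moment a + (mom_step 2 a / 2 + 1).
Proof.
rewrite /second_moment /mom_step mom_doubleS !big_ord_recl big_ord0/= /bump/= !mom_order0 !mom_order1.
by rewrite bin0 bin1 binn subn0 /=; field.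
Qed.

Lemma variance_double a : second_moment (2 * a) = second_moment a.
Proof. exact: mom_double. Qed.

Lemma mom_step_double k a : mom_step k (2 * a) = mom k (2 * a).+1 - mom k a.
Proof. by rewrite /mom_step mom_double. Qed.

Lemma mom_step_doubleS k a : mom_step k (2 * a).+1 = mom k a + mom_step k a - mom k (2 * a).+1.
Proof.
rewrite /mom_step [in RHS](addrC (mom k a)) subrK; congr (_ - _).
by have -> : (2 * a).+2 = (2 * a.+1)%N by [lia]; rewrite mom_double.
Qed.

Lemma variance_step_double a : mom_step 2 (2 * a) = mom_step 2 a / 2 + 1.
Proof. by have := variance_doubleS a; rewrite mom_step_double /second_moment; lra. Qed.

Lemma variance_step_doubleS a : mom_step 2 (2 * a).+1 = mom_step 2 a / 2 - 1.
Proof. by have := variance_doubleS a; rewrite mom_step_doubleS /second_moment; lra. Qed.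

Lemma digitO_variance_step : digitO 0 (mom_step 2).
Proof.
apply: digitO_halving.
- by apply: eq_digitO (@digitO_cst R 0 1) => a; rewrite variance_step_double; lra.
- by apply: eq_digitO (@digitO_cst R 0 (-1)) => a; rewrite variance_step_doubleS; lra.
Qed.

Lemma digitO_variance : digitO 2 second_moment.
Proof.
apply: digitO_increments.
- by apply: eq_digitO (@digitO_cst R 0 0) => a; rewrite variance_double subrr.
- apply: (@eq_digitO _ _ (fun a => 2^-1 * mom_step 2 a + 1)).
    by move=> a; rewrite variance_doubleS; lra.
  by apply: digitOD; [apply: digitOZ; exact: digitO_variance_step|exact: digitO_cst].
Qed.

(** For k <= 2 the subtractions truncate harmlessly, both errors being identically 0. *)
Definition moment_bound k := digitO (k - 1) (mom_err k) /\ digitO (k - 3) (step_err k).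

Lemma digitO_mom k : moment_bound k -> digitO k (mom k).
Proof.
move=> [OE _]; apply: (@eq_digitO _ _ (fun a => mom_err k a + normal_moment k (second_moment a))).
  by move=> a; rewrite /mom_err subrK.
apply: digitOD; first by apply: digitO_weak OE; rewrite leq_subr.
exact/digitO_normal_moment/digitO_variance.
Qed.

Lemma digitO_mom_step k : moment_bound k -> digitO (k - 2) (mom_step k).
Proof.
move=> [_ OF]; apply: (@eq_digitO _ _ (fun a => step_err k a +
    mom_step 2 a * ('C(k, 2)%:R * normal_moment (k - 2) (second_moment a)))).
  by move=> a; rewrite /step_err subrK.
apply: digitOD; first by apply: digitO_weak OF; rewrite leq_sub2l.
apply: (@digitOM _ 0 (k - 2)); first exact: digitO_variance_step.
by apply: digitOZ; exact/digitO_normal_moment/digitO_variance.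
Qed.

Lemma digitO_mom_succ k : moment_bound k -> digitO k (fun a => mom k a.+1).
Proof.
move=> Mk; apply: (@eq_digitO _ _ (fun a => mom k a + mom_step k a)).
  by move=> a; rewrite /mom_step addrC subrK.
apply: digitOD; first exact: digitO_mom.
by apply: digitO_weak (digitO_mom_step Mk); rewrite leq_subr.
Qed.

(** In the binomial sum, i = 0 gives m_(k+3) and half its increment; i = 1 only an increment of
    m_(k+2), of order k; i = 2 gives m_(k+1), replaced by its normal value at a cost of order k; and
    i >= 3 involves moments of order at most k. *)
Lemma mom_doubleS_expansion k : (forall j, (j < k.+3)%N -> moment_bound j) ->
  digitO k (fun a => mom k.+3 (2 * a).+1 - (mom k.+3 a + mom_step k.+3 a / 2
    + 'C(k.+3, 2)%:R * normal_moment k.+1 (second_moment a))).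
Proof.
move=> IH.
pose T i a : R := 'C(k.+3, i)%:R * (mom (k.+3 - i) a + (-1) ^+ i * mom (k.+3 - i) a.+1).
apply: (@eq_digitO _ _ (fun a => (\sum_(i < k.+1) T i.+3 a) / 2
   - k.+3%:R / 2 * mom_step k.+2 a
   + 'C(k.+3, 2)%:R * (mom_err k.+1 a + mom_step k.+1 a / 2))).
  move=> a; rewrite mom_doubleS.
  have -> : \sum_(i < k.+4) (mom (k.+3 - i) a + (-1) ^+ i * mom (k.+3 - i) a.+1) *+ 'C(k.+3, i) =
      T 0%N a + (T 1%N a + (T 2%N a + \sum_(i < k.+1) T i.+3 a)).
    rewrite -(@big_ord_recl _ _ _ k.+1 (fun i => T i.+2 a)).
    rewrite -(@big_ord_recl _ _ _ k.+2 (fun i => T i.+1 a)).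
    rewrite -(@big_ord_recl _ _ _ k.+3 (fun i => T i a)).
    by apply: eq_bigr => i _; rewrite /T mulr_natl.
  move: (\sum_(i < k.+1) T i.+3 a) => S.
  rewrite /T bin0 bin1 subn0 !subSS !subn0 /mom_err /mom_step expr0 expr1 expr2.
  move: ('C(k.+3, 2)%:R) (k.+3%:R) (normal_moment _ _) (mom k.+3 a) (mom k.+3 a.+1)
    (mom k.+2 a) (mom k.+2 a.+1) (mom k.+1 a) (mom k.+1 a.+1) => *.
  by field.
apply: digitOD; first apply: digitOB.
- apply: (@eq_digitO _ _ (fun a => 2^-1 * (\sum_(i < k.+1) T i.+3 a))) => [a|].
    by rewrite mulrC.
  apply: digitOZ; apply: (digitO_sum (F := fun i a => T i.+3 a)) => i ik.
  have Mi : moment_bound (k.+3 - i.+3) by apply: IH; lia.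
  have ki : (k.+3 - i.+3 <= k)%N by lia.
  apply: digitOZ; apply: digitOD; first exact: digitO_weak (digitO_mom Mi).
  by apply: digitOZ; exact: digitO_weak (digitO_mom_succ Mi).
- apply: digitOZ; have := digitO_mom_step (IH k.+2 (ltnSn _)).
  by rewrite !subSS subn0.
- apply: digitOZ; have M1 := IH k.+1 (ltnW (ltnSn _)).
  apply: digitOD; first by have [+ _] := M1; rewrite subSS subn0.
  under [X in digitO _ X]eq_fun do rewrite mulrC.
  by apply: digitOZ; apply: digitO_weak (digitO_mom_step M1); lia.
Qed.

Lemma moment_bound_all k : moment_bound k.
Proof.
elim/ltn_ind: k => -[|[|[|k]]] IH.
- split.
  + apply: eq_digitO (@digitO_cst R _ 0) => a.
    by rewrite /mom_err mom_order0 -[X in normal_moment X]/(2 * 0)%N normal_moment_double normal_coef0 expr0 mulr1 subrr.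
  + apply: eq_digitO (@digitO_cst R _ 0) => a.
    by rewrite /step_err /mom_step !mom_order0 bin_small// mul0r mulr0 !subrr.
- split.
  + apply: eq_digitO (@digitO_cst R _ 0) => a.
    by rewrite /mom_err mom_order1 -[X in normal_moment X]/(2 * 0).+1 normal_moment_doubleS subrr.
  + apply: eq_digitO (@digitO_cst R _ 0) => a.
    by rewrite /step_err /mom_step !mom_order1 bin_small// mul0r mulr0 !subrr.
- split.
  + apply: eq_digitO (@digitO_cst R _ 0) => a.
    by rewrite /mom_err -[X in normal_moment X]/(2 * 1)%N normal_moment_double normal_coef1 mul1r expr1 subrr.
  + apply: eq_digitO (@digitO_cst R _ 0) => a.
    rewrite /step_err binn subnn -[X in normal_moment X]/(2 * 0)%N normal_moment_double normal_coef0.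
    by rewrite expr0 !mulr1 subrr.
have OV := digitO_variance; have OD := digitO_variance_step.
have Oexp := mom_doubleS_expansion IH.
set X := (X in digitO k X) in Oexp.
have Oh : digitO 0 (fun a => mom_step 2 a / 2 + 1).
  apply: digitOD; last exact: digitO_cst.
  by under [X in digitO _ X]eq_fun do rewrite mulrC; exact: digitOZ.
have Oshift := normal_moment_shift k OV Oh.
have Otaylor := normal_moment_taylor k OV Oh.
have OF : digitO k (step_err k.+3).
  (* After a digit 0 the defect of halving is exactly [X]; after a digit 1 it is [- X] plus a
     bounded multiple of the change of G_(k+1) under the bounded increment of the variance. *)
  apply: digitO_halving.
    apply: eq_digitO Oexp => a; rewrite /X /step_err mom_step_double variance_step_double variance_double.
    by rewrite !subSS subn0; field.
  apply: (@eq_digitO _ _ (fun a => - X a - (2^-1 * mom_step 2 a - 1) * ('C(k.+3, 2)%:R *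
    (normal_moment k.+1 (second_moment a + (mom_step 2 a / 2 + 1)) - normal_moment k.+1 (second_moment a))))).
    move=> a; rewrite /X /step_err mom_step_doubleS variance_step_doubleS variance_doubleS.
    by rewrite !subSS subn0; field.
  apply: digitOB; first exact: digitON.
  rewrite -[k]add0n; apply: digitOM; last exact: digitOZ.
  by apply: digitOB; [exact: digitOZ|exact: digitO_cst].
split; last by rewrite !subSS subn0.
rewrite subSS subn0; apply: digitO_increments.
  by apply: eq_digitO (@digitO_cst R _ 0) => a; rewrite /mom_err variance_double mom_double subrr.
(* The variance grows by [mom_step 2 a / 2 + 1]: the first summand pairs with the main term of the
   increment of m_(k+3), the second with the i = 2 term, and only a Taylor remainder survives. *)
apply: (@eq_digitO _ _ (fun a => X a + 2^-1 * step_err k.+3 a -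
  (normal_moment k.+3 (second_moment a + (mom_step 2 a / 2 + 1)) - normal_moment k.+3 (second_moment a)
     - (mom_step 2 a / 2 + 1) * ('C(k.+3, 2)%:R * normal_moment k.+1 (second_moment a))))).
  by move=> a; rewrite /X /step_err /mom_err variance_doubleS !subSS subn0; field.
by apply: digitOB => //; apply: digitOD => //; exact: digitOZ.
Qed.

Lemma mom_asymptotics k : digitO (k - 1) (fun a => mom k a - normal_moment k (second_moment a)).
Proof. by have [] := moment_bound_all k. Qed.
End moment_asymptotics.

(** * Fluctuations of the variance *)

Lemma low_digit l a : (a < 2 ^ l.+1)%N ->
  exists b (x : bool), (b < 2 ^ l)%N /\ a = (2 * b + x)%N.
Proof.
move=> al; exists a./2, (odd a); split; first exact: half_lt_pow.
by rewrite mul2n addnC odd_double_half.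
Qed.

Section digit_sums.
Context {R : realType} (V delta : nat -> R) (K : R).
Hypothesis V0 : V 0%N = 0.
Hypothesis V_double : forall a, V (2 * a)%N = V a.
Hypothesis V_doubleS : forall a, V (2 * a).+1 = V a + (delta a / 2 + 1).
Hypothesis delta_double : forall a, delta (2 * a)%N = delta a / 2 + 1.
Hypothesis delta_doubleS : forall a, delta (2 * a).+1 = delta a / 2 - 1.
Hypothesis delta_le : forall a, `|delta a| <= K.

Let K0 : 0 <= K. Proof. exact: le_trans (delta_le 0). Qed.

(** Both digits act on [delta] by affine maps of slope 1/2, so each low digit halves the influence
    of the high block h. *)
Lemma delta_concat l h a : (a < 2 ^ l)%N ->
  delta (2 ^ l * h + a)%N - delta a = (delta h - delta 0%N) / 2 ^+ l.
Proof.
elim: l a => [|l IH] a al.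
  have -> : a = 0%N by move: al; rewrite expn0; lia.
  by rewrite expn0 mul1n addn0 expr0 divr1.
have [b [x [bl ->]]] := low_digit al.
have -> : (2 ^ l.+1 * h + (2 * b + x) = 2 * (2 ^ l * h + b) + x)%N by rewrite expnS; lia.
have -> : (delta h - delta 0%N) / 2 ^+ l.+1 = (delta h - delta 0%N) / 2 ^+ l / 2.
  by rewrite exprSr invfM mulrA.
rewrite -(IH b bl); case: x; rewrite ?addn1 ?addn0 ?delta_double ?delta_doubleS; lra.
Qed.

(** Each low digit costs at most half the discrepancy of [delta], a geometric series; the subtracted
    term is its remaining tail, which makes the induction close. *)
Lemma V_concat l h a : (a < 2 ^ l)%N ->
  `|V (2 ^ l * h + a)%N - V a - V h| <= 2 * K - 2 * K / 2 ^+ l.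
Proof.
elim: l a => [|l IH] a al.
  have -> : a = 0%N by move: al; rewrite expn0; lia.
  by rewrite expn0 mul1n addn0 expr0 divr1 V0 subr0 subrr normr0 subrr.
have [b [x [bl ->]]] := low_digit al.
have {}IH := IH _ bl; have D := delta_concat h bl.
have -> : (2 ^ l.+1 * h + (2 * b + x) = 2 * (2 ^ l * h + b) + x)%N by rewrite expnS; lia.
have q0 : 0 <= (2 ^+ l : R)^-1 by rewrite invr_ge0 exprn_ge0.
have -> : 2 * K / 2 ^+ l.+1 = 2 * K / 2 ^+ l / 2 by rewrite exprSr invfM mulrA.
have Kq : `|(delta h - delta 0%N) / 2 ^+ l| <= 2 * K / 2 ^+ l.
  rewrite normrM [X in _ * X]ger0_norm// ler_wpM2r//.
  rewrite (le_trans (ler_normB _ _))//; have := delta_le h; have := delta_le 0; lra.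
rewrite -D in Kq; have := IH; have Kq0 := le_trans (normr_ge0 _) Kq.
case: x; rewrite ?addn1 ?addn0 ?V_double ?V_doubleS; last by lra.
move: IH Kq; rewrite !ler_norml => /andP[h1 h2] /andP[h3 h4] _; apply/andP; split; lra.
Qed.

Lemma V_le n h : (h < 2 ^ n)%N -> `|V h| <= n%:R * (K / 2 + 1).
Proof.
elim: n h => [|n IH] h hn.
  have -> : h = 0%N by move: hn; rewrite expn0; lia.
  by rewrite V0 normr0 mul0r.
have [b [x [bn ->]]] := low_digit hn.
have {}IH := IH _ bn; rewrite -natr1 mulrDl mul1r.
case: x; rewrite ?addn1 ?addn0 ?V_double ?V_doubleS; last by have := K0; lra.
have := delta_le b; have := ler_normD (V b) (delta b / 2 + 1).
have := ler_normD (delta b / 2) 1; rewrite normr1 normrM (@ger0_norm _ 2^-1) ?invr_ge0//; lra.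
Qed.

(* The correction delta / 2 turns V, up to the drift 1 / 2 per digit, into a
   martingale in the random digits. *)
Definition fluctuation (N a : nat) : R := V a + delta a / 2 - 1 - N%:R / 2.

Lemma fluctuation_double N a :
  fluctuation N.+1 (2 * a) = fluctuation N a - delta a / 4.
Proof. by rewrite /fluctuation V_double delta_double -natr1; field. Qed.

Lemma fluctuation_doubleS N a :
  fluctuation N.+1 (2 * a).+1 = fluctuation N a + delta a / 4.
Proof. by rewrite /fluctuation V_doubleS delta_doubleS -natr1; field. Qed.

Lemma delta0 : delta 0%N = 2.
Proof. by have := delta_double 0; rewrite muln0; lra. Qed.

(** The two digits contribute opposite increments, so the cross terms cancel. The constant 1 in
    [fluctuation] is [delta 0 / 2], which makes the sum start at 0. *)
Lemma sum_fluctuation_sqr N :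
  \sum_(a < 2 ^ N) fluctuation N a ^+ 2 <= 2 ^+ N * N%:R * K ^+ 2.
Proof.
elim: N => [|N IH].
  by rewrite expn0 big_ord1 mulr0 mul0r /fluctuation V0 delta0 mul0r subr0 divff// add0r subrr expr0n.
rewrite (big_halves _ (fun a => fluctuation N.+1 a ^+ 2)) expnS mul2n uphalf_double doubleK -big_split/=.
apply: (@le_trans _ _ (\sum_(a < 2 ^ N) (2 * fluctuation N a ^+ 2 + 2 * K ^+ 2))).
  apply: ler_sum => a _; rewrite fluctuation_double fluctuation_doubleS.
  have : delta a ^+ 2 <= K ^+ 2 by rewrite -ler_sqrt ?sqr_ge0// !sqrtr_sqr (ger0_norm K0).
  by have := sqr_ge0 (delta a); nra.
rewrite big_split/= -mulr_sumr sumr_const card_ord -[X in _ + X]mulr_natl natrX.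
rewrite (exprS _ N) -[N.+1%:R]natr1; apply: le_trans (lerD (ler_wpM2l _ IH) (lexx _)) _ => //; lra.
Qed.

(** Chebyshev's inequality for the uniform law on the integers below 2^N. *)
Lemma count_fluctuation N (t : R) : 0 < t ->
  (\sum_(a < 2 ^ N) (t < `|fluctuation N a|)%R)%:R <= 2 ^+ N * (N%:R * K ^+ 2 / t ^+ 2).
Proof.
move=> t0; rewrite mulrA ler_pdivlMr ?exprn_gt0// mulrA.
apply: le_trans (sum_fluctuation_sqr N).
rewrite natr_sum mulr_suml; apply: ler_sum => a _.
case: ltP => [tf|_]; last by rewrite mul0r sqr_ge0.
by rewrite mul1r -(real_normK (num_real (fluctuation _ _))) lerXn2r ?nnegrE ?ltW// (lt_trans t0).
Qed.
End digit_sums.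

(** * Almost sure growth of the variance *)

Section bits.
Variable X : nat -> bool.

Lemma a_ofS n : a_of X n.+1 = (2 ^ n.+1 * X n.+1 + a_of X n)%N.
Proof. by rewrite /a_of big_ord_recr/= addnC mulnC. Qed.

Lemma a_of_lt n : (a_of X n < 2 ^ n.+1)%N.
Proof.
elim: n => [|n IH]; first by rewrite /a_of big_ord1 /= muln1; case: (X 0).
by rewrite a_ofS (expnS _ n.+1); case: (X n.+1); lia.
Qed.

Lemma a_of_concat n d : exists2 h, (h < 2 ^ d)%N & a_of X (n + d) = (2 ^ n.+1 * h + a_of X n)%N.
Proof.
elim: d => [|d [h hd IH]]; first by exists 0%N; rewrite ?expn0// addn0 muln0.
exists (2 ^ d * X (n + d).+1 + h)%N.
  by rewrite expnS; case: (X _); lia.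
rewrite addnS a_ofS IH addnA mulnDr; congr (_ + _ + _)%N.
by rewrite mulnA -expnD addSn.
Qed.

Lemma bit_a_of n j : (j <= n)%N -> odd (a_of X n %/ 2 ^ j) = X j.
Proof.
elim: n => [|n IH].
  by rewrite leqn0 => /eqP ->; rewrite /a_of big_ord1 muln1 divn1 oddb.
rewrite leq_eqVlt a_ofS => /predU1P[->|jn].
  by rewrite mulnC divnMDl ?expn_gt0// divn_small ?a_of_lt// addn0 oddb.
have -> : (2 ^ n.+1 * X n.+1 = (2 ^ (n - j).+1 * X n.+1) * 2 ^ j)%N.
  by rewrite mulnAC -expnD; congr (2 ^ _ * _)%N; lia.
by rewrite divnMDl ?expn_gt0// oddD oddM oddX/= IH.
Qed.
End bits.

(** * Cylinders and the Borel-Cantelli argument *)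

Section bernoulli.
Context {R : realType} (P : probability bitsequences R).
Hypothesis hP : balanced_bernoulli P.

(** The prefix is coded by an integer, and the intersection is over an [fset] to match
    [mutually_independent]. *)
Definition cylinder (N a : nat) : set bitsequences :=
  \bigcap_(j in [set` [fset i in iota 0 N]%fset])
    (fun X : bitsequences => X j) @^-1` [set odd (a %/ 2 ^ j)].

Lemma measurable_coordinate j (b : bool) :
  measurable ((fun X : bitsequences => X j) @^-1` [set b]).
Proof.
apply: sub_sigma_algebra; exists j => //; exists [set b] => //.
by rewrite setTI.
Qed.

Lemma measurable_cylinder N a : measurable (cylinder N a).
Proof.
by apply: fin_bigcap_measurable => // j _; exact: measurable_coordinate.
Qed.

Lemma cylinder_prob N a : P (cylinder N a) = ((2^-1) ^+ N)%:E.
Proof.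
case: hP => ind half; rewrite (ind _ (fun j => [set odd (a %/ 2 ^ j)])).
rewrite (eq_bigr (fun=> (2^-1)%:E)) => [|j _]; last exact: half.
by rewrite prodEFin big_const_seq count_predT iter_mulr_1 card_fseq undup_id ?iota_uniq// size_iota.
Qed.

Lemma mem_cylinder (X : bitsequences) n : cylinder n.+1 (a_of X n) X.
Proof. by move=> j; rewrite /= !inE mem_iota => jn; rewrite bit_a_of//; lia. Qed.

Definition union_cylinders N (B : pred nat) : set bitsequences :=
  \big[setU/set0]_(a < 2 ^ N) (if B a then cylinder N a else set0).

Lemma measurable_union_cylinders N B : measurable (union_cylinders N B).
Proof.
by apply: bigsetU_measurable => a _; case: ifP => // _; exact: measurable_cylinder.
Qed.

Lemma union_cylinders_prob N B :
  (P (union_cylinders N B) <= ((\sum_(a < 2 ^ N) B a)%:R * 2^-1 ^+ N)%:E)%E.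
Proof.
apply: le_trans (Boole_inequality P (A := fun a => if B a then cylinder N a else set0) _) _.
  by move=> a _; case: ifP => // _; exact: measurable_cylinder.
rewrite natr_sum mulr_suml -sumEFin; apply: lee_sum => a _.
by case: (B a); rewrite /= ?measure0 ?mul0r// mul1r cylinder_prob.
Qed.

Lemma mem_union_cylinders (X : bitsequences) n (B : pred nat) :
  B (a_of X n) -> union_cylinders n.+1 B X.
Proof.
move=> Ba; rewrite /union_cylinders (bigD1 (Ordinal (a_of_lt X n)))//= Ba; left; exact: mem_cylinder.
Qed.

Section variance_growth.
Variables (V delta : nat -> R) (K : R).
Hypothesis V0 : V 0%N = 0.
Hypothesis V_double : forall a, V (2 * a)%N = V a.
Hypothesis V_doubleS : forall a, V (2 * a).+1 = V a + (delta a / 2 + 1).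
Hypothesis delta_double : forall a, delta (2 * a)%N = delta a / 2 + 1.
Hypothesis delta_doubleS : forall a, delta (2 * a).+1 = delta a / 2 - 1.
Hypothesis delta_le : forall a, `|delta a| <= K.
Local Notation fluctuation := (fluctuation V delta).

(** With x = m+1, a_X(x^4) has x^4 + 1 digits. The threshold x^3 is negligible against x^4, gives by
    Chebyshev a probability O(x^4 / x^6), which is summable, and is of the order of the gap between
    consecutive fourth powers. *)
Definition deviation m : set bitsequences := union_cylinders (m.+1 ^ 4).+1
  (fun a => m.+1%:R ^+ 3 < `|fluctuation (m.+1 ^ 4).+1 a|).

Lemma deviation_prob m : (P (deviation m) <= (2 * K ^+ 2 / m.+1%:R ^+ 2)%:E)%E.
Proof.
apply: le_trans (union_cylinders_prob _ _) _; rewrite lee_fin.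
set N := (m.+1 ^ 4).+1; set x : R := m.+1%:R.
have x1 : 1 <= x by rewrite ler1n.
have x0 : 0 < x by exact: lt_le_trans x1.
have c := count_fluctuation V0 V_double V_doubleS delta_double delta_doubleS delta_le N (exprn_gt0 3 x0).
have q0 : 0 < (2^-1 : R) ^+ N by rewrite exprn_gt0.
apply: le_trans (ler_wpM2r (ltW q0) c) _.
rewrite mulrAC -exprMn divff// expr1n mul1r.
have Nx : N%:R <= 2 * x ^+ 4.
  rewrite /N -natr1 natrX -/x; have : 1 <= x ^+ 4 by rewrite exprn_ege1.
  by lra.
rewrite ler_pdivrMr ?exprn_gt0// (le_trans (ler_wpM2r (sqr_ge0 K) Nx))//.
have -> : 2 * K ^+ 2 / x ^+ 2 * x ^+ 3 ^+ 2 = 2 * x ^+ 4 * K ^+ 2 by field; rewrite gt_eqF.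
exact: lexx.
Qed.

Lemma sum_inv_sqr n : \sum_(m < n) ((m.+1%:R : R) ^+ 2)^-1 <= 2.
Proof.
(* The strengthened bound telescopes, since 1/(x+1)^2 <= 1/x - 1/(x+1). *)
suff h : \sum_(m < n.+1) ((m.+1%:R : R) ^+ 2)^-1 <= 2 - (n.+1%:R)^-1.
  apply: (@le_trans _ _ (\sum_(m < n.+1) ((m.+1%:R : R) ^+ 2)^-1)).
    by rewrite big_ord_recr/= lerDl invr_ge0 exprn_ge0.
  by rewrite (le_trans h)// gerBl invr_ge0.
elim: n => [|n IH]; first by rewrite big_ord1 expr1n invr1; lra.
rewrite big_ord_recr/=.
set x : R := n.+1%:R in IH *; have x0 : 0 < x by rewrite ltr0n.
have -> : n.+2%:R = x + 1 :> R by rewrite natr1.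
have y0 : 0 < x + 1 by rewrite addr_gt0.
have E : x^-1 - (x + 1)^-1 - ((x + 1) ^+ 2)^-1 = (x * (x + 1) ^+ 2)^-1.
  by field; rewrite !gt_eqF.
have : 0 <= (x * (x + 1) ^+ 2)^-1 by rewrite invr_ge0 mulr_ge0 ?sqr_ge0 ?ltW.
rewrite -E => h; apply: le_trans (lerD IH (lexx _)) _.
by move: (x^-1) (x + 1)^-1 ((x + 1) ^- 2) h => p q r h; lra.
Qed.

Lemma deviation_limsup : P (lim_sup_set deviation) = 0%E.
Proof.
apply: lim_sup_set_cvg0 => [m|]; first exact: measurable_union_cylinders.
apply: (@le_lt_trans _ _ ((2 * K ^+ 2 * 2)%:E)); last exact: ltry.
apply: lime_le; first by apply: is_cvg_nneseries => n _ _; exact: measure_ge0.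
apply: nearW => n; rewrite big_mkord.
apply: (@le_trans _ _ (\sum_(m < n) (2 * K ^+ 2 / m.+1%:R ^+ 2)%:E)).
  by apply: lee_sum => m _; exact: deviation_prob.
rewrite sumEFin lee_fin -mulr_sumr ler_wpM2l ?sum_inv_sqr//.
by rewrite mulr_ge0 ?sqr_ge0.
Qed.

Lemma fourth_root n : exists M, (M ^ 4 <= n < M.+1 ^ 4)%N.
Proof.
elim: n => [|n [M /andP[h1 h2]]]; first by exists 0%N.
have [h|h] := ltnP n.+1 (M.+1 ^ 4); first by exists M; rewrite (leqW h1) h.
exists M.+1; rewrite h (leq_ltn_trans h2)// ltn_exp2r//.
Qed.

(* Between fourth powers, V is controlled by splitting off the highest digits. *)
Lemma V_deviation_le (X : bitsequences) M n : (M.+1 ^ 4 <= n < M.+2 ^ 4)%N ->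
  ~ deviation M X -> `|V (a_of X n) - n%:R / 2| <= (30 + 15 * K) * M.+1%:R ^+ 3.
Proof.
move=> /andP[Mn nM] nX; set N := (M.+1 ^ 4)%N in Mn *.
set x : R := M.+1%:R; have x1 : 1 <= x by rewrite ler1n.
have fl : `|fluctuation N.+1 (a_of X N)| <= x ^+ 3.
  rewrite leNgt; apply/negP => h; apply: nX; exact: (@mem_union_cylinders X N (fun a => _ < `|fluctuation N.+1 a|)).
have [h hd E] := a_of_concat X N (n - N); rewrite subnKC// in E.
have Vc := V_concat V0 V_double V_doubleS delta_double delta_doubleS delta_le h (a_of_lt X N).
have Vh := V_le V0 V_double V_doubleS delta_le hd.
have q0 : 0 <= 2 * K / 2 ^+ N.+1.
  by rewrite divr_ge0 ?exprn_ge0// mulr_ge0// (le_trans _ (delta_le 0)).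
rewrite -E in Vc.
have dl := delta_le (a_of X N).
have nN : (n - N)%:R = n%:R - x ^+ 4 :> R by rewrite natrB// natrX.
have nx : n%:R <= (x + 1) ^+ 4.
  by rewrite /x natr1 -natrX ler_nat ltnW.
have xn : x ^+ 4 <= n%:R by rewrite /x -natrX ler_nat.
have x3 : 1 <= x ^+ 3 by rewrite exprn_ege1.
(* 15 = 4 + 6 + 4 + 1, the lower coefficients of (x+1)^4, each power being at most x^3. *)
have gap : n%:R - x ^+ 4 <= 15 * x ^+ 3.
  have x2 : x ^+ 2 <= x ^+ 3 by rewrite ler_weXn2l.
  have x1' : x <= x ^+ 3 by rewrite -{1}(expr1 x) ler_weXn2l.
  have e4 : (x + 1) ^+ 4 = x ^+ 4 + 4 * x ^+ 3 + 6 * x ^+ 2 + 4 * x + 1 by ring.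
  by move: nx; rewrite e4; lra.
have K0 : 0 <= K by rewrite (le_trans _ (delta_le 0)).
have Vg : (n - N)%:R * (K / 2 + 1) <= 15 * x ^+ 3 * (K / 2 + 1).
  by rewrite nN ler_wpM2r//; lra.
have Kx : K <= K * x ^+ 3 by rewrite ler_peMr.
have NE : N.+1%:R = x ^+ 4 + 1 :> R by rewrite -natr1 natrX.
have {Vh Vg} Vh := le_trans Vh Vg.
move: fl; rewrite /fluctuation NE => fl.
move: fl Vc Vh dl q0; set q := 2 * K / _.
move: (V (a_of X n)) (V (a_of X N)) (V h) (delta _) q => v v' w d q.
rewrite !ler_norml => /andP[f1 f2] /andP[c1 c2] /andP[w1 w2] /andP[d1 d2] q0.
have E15 : 15 * x ^+ 3 * (K / 2 + 1) = 15 / 2 * (K * x ^+ 3) + 15 * x ^+ 3 by field.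
rewrite E15 in w1 w2; rewrite mulrDl -mulrA.
by move: (K * x ^+ 3) (x ^+ 3) (x ^+ 4) Kx x3 xn gap f1 f2 w1 w2 => y z t *; apply/andP; split; lra.
Qed.

Lemma cvg_V_ratio (X : bitsequences) m0 : (forall m, (m0 <= m)%N -> ~ deviation m X) ->
  V (a_of X n) / n%:R @[n --> \oo] --> (2^-1 : R).
Proof.
move=> nX; apply/cvgrPdist_le => /= e e0.
have K0 : 0 <= K by rewrite (le_trans _ (delta_le 0)).
have C0 : 0 < 30 + 15 * K by rewrite ltr_pwDl// mulr_ge0.
have [M1 HM1] : exists M1 : nat, (30 + 15 * K) / e <= M1%:R.
  by exists (Num.bound ((30 + 15 * K) / e)); rewrite ltW// archi_boundP// divr_ge0 ?ltW.
near=> n.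
have n1 : ((maxn m0 M1).+2 ^ 4 <= n)%N by near: n; exact: nbhs_infty_ge.
have [[|M] /andP[h1 h2]] := fourth_root n.
  by have := leq_ltn_trans n1 h2; rewrite ltn_exp2r//; lia.
have MM : (maxn m0 M1 <= M)%N.
  by have := leq_ltn_trans n1 h2; rewrite ltn_exp2r//; lia.
have := V_deviation_le (introT andP (conj h1 h2)) (nX M (leq_trans (leq_maxl _ _) MM)).
have x0 : 0 < M.+1%:R :> R by rewrite ltr0n.
have xM : M1%:R <= M.+1%:R :> R by rewrite ler_nat leqW// (leq_trans (leq_maxr _ _) MM).
have xn : M.+1%:R ^+ 4 <= n%:R :> R by rewrite -natrX ler_nat.
move: (M.+1%:R : R) x0 xM xn => x x0 xM xn Vn.
have n0 : 0 < n%:R :> R by rewrite (lt_le_trans _ xn)// exprn_gt0.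
rewrite distrC.
have -> : V (a_of X n) / n%:R - 2^-1 = (V (a_of X n) - n%:R / 2) / n%:R by field; rewrite gt_eqF.
rewrite normrM normfV (ger0_norm (ltW n0)) ler_pdivrMr// (le_trans Vn)//.
have ex : 30 + 15 * K <= e * x by rewrite (mulrC e) -ler_pdivrMr// (le_trans HM1).
apply: (@le_trans _ _ (e * x * x ^+ 3)); first by rewrite ler_wpM2r// exprn_ge0// ltW.
by rewrite -mulrA -exprS ler_wpM2l// ltW.
Unshelve. all: by end_near.
Qed.

Lemma ae_cvg_V_ratio :
  {ae P, forall X : bitsequences, V (a_of X n) / n%:R @[n --> \oo] --> (2^-1 : R)}.
Proof.
exists (lim_sup_set deviation); split.
- apply: bigcapT_measurable => n; apply: bigcup_measurable => m _.
  exact: measurable_union_cylinders.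
- exact: deviation_limsup.
- move=> X; apply: contra_notP => nX.
  have [m0 Hm0] : exists m0, forall m, (m0 <= m)%N -> ~ deviation m X.
    apply: contrapT => H; apply: nX => n _; apply: contrapT => H'.
    by apply: H; exists n => m nm dm; apply: H'; exists m.
  exact: cvg_V_ratio Hm0.
Qed.
End variance_growth.
End bernoulli.

(** * Moments of the normal law *)

Section gaussian_moments.
Context {R : realType}.
Local Notation lam := (@lebesgue_measure R).
Local Notation phi := (@normal_pdf R 0 1).

(** The Radon-Nikodym derivative agrees almost everywhere with the explicit density, as both have
    the same integral over each measurable set. *)
Lemma ge0_integral_normal_prob (f : R -> \bar R) : (forall x, 0 <= f x)%E ->
  measurable_fun [set: R] f ->
  (\int[normal_prob 0 1]_x f x = \int[lam]_x (f x * (phi x)%:E))%E.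
Proof.
move=> f0 mf.
have dom := @normal_prob_dominates R 0 1.
rewrite -(Radon_Nikodym_SigmaFinite.change_of_variables dom)//.
have ig := Radon_Nikodym_SigmaFinite.f_integrable dom.
apply: ae_eq_integral => //.
- by apply: emeasurable_funM => //; exact: (measurable_int _ ig).
- by apply: emeasurable_funM => //; apply/measurable_EFinP; exact: measurable_normal_pdf.
- apply: ae_eqe_mul2l => /=; apply: integral_ae_eq => //.
  + by apply/measurable_EFinP; exact: measurable_normal_pdf.
  + move=> E _ mE.
    by rewrite -(Radon_Nikodym_SigmaFinite.f_integral dom mE).
Qed.

Lemma normal_pdf01E (x : R) : phi x = normal_peak 1 * expR (- x ^+ 2 / 2).
Proof.
by rewrite normal_pdfE ?oner_neq0// /normal_fun subr0 expr1n.
Qed.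

Lemma normal_pdf01N (x : R) : phi (- x) = phi x.
Proof. by rewrite !normal_pdf01E sqrrN. Qed.

Lemma continuous_expr_pdf n : continuous (fun x : R => x ^+ n * phi x).
Proof.
move=> x; apply: cvgM; first exact: exprn_continuous.
by apply: continuous_normal_pdf; rewrite oner_neq0.
Qed.

Lemma is_derive_normal_pdf01 (x : R) : is_derive x 1 (phi : R -> R) (- (x * phi x)).
Proof.
have -> : (phi : R -> R) = (fun x => normal_peak 1 * expR (- x ^+ 2 / 2)).
  by apply/funext => y; rewrite normal_pdf01E.
apply: is_derive_eq.
rewrite ?derive_val /GRing.scale /= ; set e := expR _; set p : R := normal_peak _.
by field.
Qed.

(** The boundary term of the integration by parts. With y = x^2 / 2, the bound y^(k+1) / (k+1)! <=
    exp(y) leaves at most C / x for x >= 1. *)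
Lemma cvg_expr_pdf k : (n%:R ^+ k * phi n%:R) @[n --> \oo] --> (0:R).
Proof.
pose C : R := normal_peak 1 * (k.+1`!%:R * 2 ^+ k.+1).
apply/cvgrPdist_le => /= e e0.
have : (C * n.+1%:R^-1) @[n --> \oo] --> (0 : R).
  rewrite -[X in _ --> X](mulr0 C); apply: cvgM; first exact: cvg_cst.
  exact: cvg_harmonic.
rewrite (cvg_shiftS (fun n => C * n%:R^-1)) => /cvgrPdist_le/(_ _ e0).
apply: filterS2 (nbhs_infty_gt 0) => n n0.
rewrite !sub0r !normrN => Ce; apply: le_trans Ce.
have x0 : 0 < n%:R :> R by rewrite ltr0n.
have x1 : 1 <= n%:R :> R by rewrite ler1n.
move: (n%:R : R) x0 x1 => x x0 x1.
have pk0 : 0 <= normal_peak (1 : R) := normal_peak_ge0 _.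
rewrite !ger0_norm; last 2 first.
- by rewrite mulr_ge0 ?invr_ge0 ?(ltW x0)// !mulr_ge0 ?exprn_ge0 ?ler0n.
- by rewrite mulr_ge0 ?exprn_ge0 ?(ltW x0)// normal_pdf_ge0.
rewrite normal_pdf01E /C mulrCA -!mulrA ler_wpM2l// mulNr expRN.
have y0 : 0 <= x ^+ 2 / 2 by rewrite divr_ge0 ?sqr_ge0.
have h := expR_ge1Dxn k y0.
have h1 : (x ^+ 2 / 2) ^+ k.+1 / k.+1`!%:R <= expR (x ^+ 2 / 2).
  by apply: le_trans h; rewrite lerDr.
have f0 : 0 < k.+1`!%:R :> R by rewrite ltr0n fact_gt0.
have z0 : 0 < (x ^+ 2 / 2) ^+ k.+1 / k.+1`!%:R.
  by rewrite divr_gt0// exprn_gt0// divr_gt0// exprn_gt0.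
apply: (@le_trans _ _ (x ^+ k * ((x ^+ 2 / 2) ^+ k.+1 / k.+1`!%:R)^-1)).
  by rewrite ler_wpM2l ?exprn_ge0 ?(ltW x0)// lef_pV2// ?posrE ?expR_gt0.
rewrite ler_pdivrMr//.
set f := k.+1`!%:R in f0 *; set y := (_ / 2) ^+ _; set t := 2 ^+ _.
have ty : t * y = x ^+ (2 * k.+1) by rewrite -exprMn mulrC divfK// -exprM.
have -> : f * (t / x) * (y / f) = t * y / x by field; rewrite !gt_eqF.
rewrite ty ler_pdivlMr// -exprSr ler_weXn2l//.
by rewrite mul2n -addnn leq_addr.
Qed.

Lemma measurable_expr_pdf n (D : set R) :
  measurable_fun D (fun x : R => (x ^+ n * phi x)%:E).
Proof.
apply/measurable_EFinP/measurable_funTS/measurable_funM; last exact: measurable_normal_pdf.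
exact: measurable_funX.
Qed.

Lemma expr_pdf_ge0 n (x : R) : `[0, +oo[%classic x -> (0 <= (x ^+ n * phi x)%:E)%E.
Proof.
rewrite /= in_itv/= andbT => x0.
by rewrite lee_fin mulr_ge0 ?exprn_ge0// normal_pdf_ge0.
Qed.

(** On the half-line the integrand is nonnegative, so the integral makes sense before finiteness is
    known. Even moments are twice this, odd ones the difference of two copies. *)
Definition half_moment n : \bar R :=
  (\int[lam]_(x in `[0%R, +oo[) (x ^+ n * phi x)%:E)%E.

Lemma cvg_half_moment n :
  (\int[lam]_(x in `[0%R, k%:R]) (x ^+ n * phi x)%:E)%E @[k --> \oo]
   --> half_moment n.
Proof.
(* ge0_cvgn_integral needs an integrand that is nonnegative on the whole line. *)
have h (D : set R) : D `<=` [set x | 0 <= x] ->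
  (\int[lam]_(x in D) (x ^+ n * phi x)%:E = \int[lam]_(x in D) (`|x| ^+ n * phi x)%:E)%E.
  move=> D0; apply: eq_integral => x /[!inE] /D0 /= x0; by rewrite ger0_norm.
rewrite /half_moment h; last by move=> x /=; rewrite in_itv/= andbT.
under eq_cvg => k do (rewrite h; last by move=> x /=; rewrite in_itv/= => /andP[]).
apply: (@ge0_cvgn_integral R lam (fun x => `|x| ^+ n * phi x)).
- by move=> x; rewrite mulr_ge0 ?exprn_ge0// normal_pdf_ge0.
- apply: measurable_funM; last exact: measurable_normal_pdf.
  by apply: measurable_funX; exact: normr_measurable.
Qed.

Lemma half_moment0 : half_moment 0 = (2^-1)%:E.
Proof.
have sym := @ge0_symfun_integralT R (phi : R -> R) (@normal_pdf_ge0 R 0 1)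
  (@continuous_normal_pdf R 0 1 (oner_neq0 _)) (fun x => esym (normal_pdf01N x)).
rewrite integral_normal_pdf -set_itvcy in sym.
rewrite /half_moment; under eq_integral do rewrite expr0 mul1r.
case: (integral _ _ _) sym => [r||] //=.
- by rewrite -EFinM => -[h]; congr EFin; lra.
- by rewrite mulry gtr0_sg// mul1e.
- by rewrite mulrNy gtr0_sg// mul1e.
Qed.

(** [- phi] is a primitive of [x * phi x], and the boundary term at 0 vanishes because the power n+1
    is positive. *)
Lemma half_moment_by_parts n k :
  (\int[lam]_(x in `[0%R, k.+1%:R]) (x ^+ n.+2 * phi x)%:E =
   - (k.+1%:R ^+ n.+1 * phi k.+1%:R)%:E +
   n.+1%:R%:E * \int[lam]_(x in `[0%R, k.+1%:R]) (x ^+ n * phi x)%:E)%E.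
Proof.
have k0 : (0 : R) < k.+1%:R by rewrite ltr0n.
have dphi (x : R) : derivable (phi : R -> R) x 1 := @ex_derive _ _ _ _ _ _ _ (is_derive_normal_pdf01 x).
have cphi : continuous (phi : R -> R) by apply: continuous_normal_pdf; rewrite oner_neq0.
have ig : lam.-integrable `[0%R, k.+1%:R] (fun x : R => (x ^+ n * phi x)%:E).
  apply: continuous_compact_integrable; first exact: segment_compact.
  by apply: continuous_subspaceT; exact: continuous_expr_pdf.
have -> : (\int[lam]_(x in `[0%R, k.+1%:R]) (x ^+ n.+2 * phi x)%:E =
  \int[lam]_(x in `[0%R, k.+1%:R]) ((x ^+ n.+1) * (x * phi x))%:E)%E.
  by apply: eq_integral => x _; rewrite mulrA -exprSr.
rewrite (@integration_by_parts R (fun x => x ^+ n.+1) (fun x => - phi x)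
  (fun x => n.+1%:R * x ^+ n) (fun x => x * phi x)) //.
- rewrite expr0n mul0r subr0 mulrN EFinN; congr (_ + _)%E.
  under eq_integral do rewrite mulrN EFinN -mulrA EFinM.
  rewrite integralN/=; last exact/integrable_add_def/integrableZl.
  by rewrite oppeK integralZl.
- apply/continuous_subspaceT => x.
  by apply: cvgM; [exact: cvg_cst|exact: exprn_continuous].
- split.
    by move=> x x01; exact: exprn_derivable.
    exact/cvg_at_right_filter/exprn_continuous.
    exact/cvg_at_left_filter/exprn_continuous.
- by move=> x x01; rewrite derive1E exp_derive scaler1.
- by apply/continuous_subspaceT => x; apply: cvgM => //; exact: cphi.
- split.
    by move=> x _; apply: derivableN; exact: dphi.
    by apply: cvgN; apply/cvg_at_right_filter/cphi.
    by apply: cvgN; apply/cvg_at_left_filter/cphi.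
- move=> x _; rewrite derive1E deriveN//.
  by rewrite (@derive_val _ _ _ _ _ _ _ (is_derive_normal_pdf01 x)) opprK.
Qed.

Lemma half_moment_ge0 n : (0 <= half_moment n)%E.
Proof. by apply: integral_ge0 => x; exact: expr_pdf_ge0. Qed.

Lemma half_momentSS n : (half_moment n < +oo)%E ->
  half_moment n.+2 = (n.+1%:R%:E * half_moment n)%E.
Proof.
move=> fin.
have /cvg_lim <- // : (\int[lam]_(x in `[0%R, k.+1%:R]) (x ^+ n.+2 * phi x)%:E)%E
   @[k --> \oo] --> half_moment n.+2.
  by have := @cvg_half_moment n.+2; rewrite -cvg_shiftS.
apply/cvg_lim => //; rewrite -[X in _ --> X]add0e.
under eq_cvg do rewrite half_moment_by_parts.
apply: cvgeD.
- by rewrite fin_num_adde_defr.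
- apply: cvg_EFin; first exact: nearW.
  rewrite -[X in _ --> X]oppr0; apply: cvgN.
  by have := @cvg_expr_pdf n.+1; rewrite -cvg_shiftS.
- apply: cvgeZl => //.
  by have := @cvg_half_moment n; rewrite -cvg_shiftS.
Qed.

Lemma half_moment_even k :
  half_moment (2 * k) = ((2 * k)`!%:R / (2 ^+ k * k`!%:R) / 2)%:E.
Proof.
elim: k => [|k IH]; first by rewrite muln0 half_moment0 fact0 expr0 mulr1 divr1 mul1r.
rewrite mulnS addSn add1n half_momentSS; last by rewrite IH ltry.
rewrite IH -EFinM; congr EFin.
rewrite 3!factS !natrM exprS.
have -> : (2 * k).+2%:R = 2 * k.+1%:R :> R by rewrite -natrM mulnS.
by field; rewrite nat1r !pnatr_eq0 expf_neq0// -lt0n fact_gt0.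
Qed.

(** Odd powers are dominated by their even neighbours, through x <= 1 + x^2. *)
Lemma half_moment_lty n : (half_moment n < +oo)%E.
Proof.
have [k [->|->]] : exists k, n = (2 * k)%N \/ n = (2 * k + 1)%N.
  exists n./2; have := odd_double_half n; rewrite -muln2 mulnC addnC.
  by case: (odd n) => /= /esym h; [right|left]; rewrite ?addn0 in h.
  by rewrite half_moment_even ltry.
apply: (@le_lt_trans _ _ (half_moment (2 * k) + half_moment (2 * k.+1))%E); last first.
  by rewrite !half_moment_even -EFinD ltry.
rewrite /half_moment -ge0_integralD//=; try exact: measurable_expr_pdf; try exact: expr_pdf_ge0.
apply: ge0_le_integral => //=; try exact: measurable_expr_pdf; try exact: expr_pdf_ge0.
- by apply: emeasurable_funD; exact: measurable_expr_pdf.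
- move=> x x0; rewrite -EFinD lee_fin -mulrDl ler_wpM2r ?normal_pdf_ge0//.
  have -> : x ^+ (2 * k + 1) = x ^+ (2 * k) * x by rewrite exprD expr1.
  have -> : x ^+ (2 * k.+1) = x ^+ (2 * k) * x ^+ 2 by rewrite mulnS addnC exprD.
  have y0 : 0 <= x ^+ (2 * k) by rewrite exprM exprn_ge0 ?sqr_ge0.
  rewrite -[X in _ <= X + _]mulr1 -mulrDr ler_wpM2l//.
  by have := sqr_ge0 (x - 1); rewrite sqrrB; have := sqr_ge0 x; lra.
Qed.

Lemma integral_normal_even_power k :
  (\int[normal_prob (0 : R) 1]_x (x ^+ (2 * k))%:E =
      ((2 * k)`!%:R / (2 ^+ k * k`!%:R))%:E)%E.
Proof.
rewrite ge0_integral_normal_prob; last 2 first.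
- by move=> x; rewrite lee_fin exprM exprn_ge0 ?sqr_ge0.
- by apply/measurable_EFinP; exact: measurable_funX.
under eq_integral do rewrite -EFinM.
rewrite ge0_symfun_integralT; last 3 first.
- by move=> x; rewrite mulr_ge0 ?normal_pdf_ge0// exprM exprn_ge0 ?sqr_ge0.
- exact: continuous_expr_pdf.
- by move=> x; rewrite /= normal_pdf01N !exprM sqrrN.
rewrite -set_itvcy -[X in (_ * X)%E]/(half_moment _) half_moment_even -EFinM.
by rewrite mulrC divfK.
Qed.

Lemma integral_normal_odd_power k :
  (\int[normal_prob (0 : R) 1]_x (x ^+ (2 * k + 1))%:E = 0)%E.
Proof.
set n := (2 * k + 1)%N.
have on : odd n by rewrite /n oddD oddM.
have mf : measurable_fun [set: R] (fun x : R => (x ^+ n)%:E).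
  by apply/measurable_EFinP; exact: measurable_funX.
rewrite integralE.
rewrite !ge0_integral_normal_prob; last 4 first.
- by move=> x; exact: funeneg_ge0.
- exact: measurable_funeneg.
- by move=> x; exact: funepos_ge0.
- exact: measurable_funepos.
have pos : (\int[lam]_x ((fun x : R => (x ^+ n)%:E)^\+ x * (phi x)%:E) = half_moment n)%E.
  rewrite /half_moment [RHS]integral_mkcond; apply: eq_integral => x _.
  rewrite patchE funeposE -EFin_max -EFinM; case: ifPn.
    by rewrite inE/= in_itv/= andbT => x0; rewrite max_l// exprn_ge0.
  move=> /negP; rewrite inE/= in_itv/= andbT => /negP; rewrite -ltNge => x0.
  by rewrite max_r ?mul0r// ltW// exprn_odd_lt0.
have neg : (\int[lam]_x ((fun x : R => (x ^+ n)%:E)^\- x * (phi x)%:E) = half_moment n)%E.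
  (* The endpoint is written [- 0] to fit the substitution x -> -x. *)
  transitivity (\int[lam]_(x in `]-oo, (- 0)%R]) (- x ^+ n * phi x)%:E)%E.
    rewrite oppr0 [RHS]integral_mkcond; apply: eq_integral => x _.
    rewrite patchE funenegE -EFinN -EFin_max -EFinM; case: ifPn.
      rewrite inE/= in_itv/= => x0; rewrite max_l// oppr_ge0.
      by rewrite exprn_odd_le0.
    move=> /negP; rewrite inE/= in_itv/= => /negP; rewrite -ltNge => x0.
    by rewrite max_r ?mul0r// oppr_le0 exprn_ge0// ltW.
  rewrite ge0_integration_by_substitutionNy; last 2 first.
  - apply: continuous_subspaceT => x; apply: cvgM.
      by apply: cvgN; exact: exprn_continuous.
    by apply: continuous_normal_pdf; rewrite oner_neq0.
  - move=> x; rewrite oppr0 in_itv/= => x0.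
    by rewrite mulr_ge0 ?normal_pdf_ge0// oppr_ge0 exprn_odd_le0// ltW.
  apply: eq_integral => x _ /=.
  by rewrite normal_pdf01N exprNn -signr_odd on expr1 mulN1r opprK.
by rewrite pos neg subee// ge0_fin_numE ?half_moment_lty// half_moment_ge0.
Qed.
End gaussian_moments.

(** * Convergence of the rescaled moments *)

Section assembly.
Context {R : realType}.
Local Notation mom := (@mom R).
Local Notation variance := (second_moment mom).

Lemma scaled_momentE k X n : scaled_moment k X n =
  (Num.sqrt 2 ^+ k * (mom k (a_of X n) / Num.sqrt n%:R ^+ k))%:E.
Proof.
rewrite /scaled_moment momentE -EFinM; congr EFin.
have -> : Num.sqrt (2 ^+ k) = Num.sqrt 2 ^+ k :> R.
  elim: k => [|k IH]; first by rewrite !expr0 sqrtr1.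
  by rewrite !exprS sqrtrM// IH.
rewrite mulrC mulrA (mulrC k%:R) powRrM powR12_sqrt// powR_mulrn ?sqrtr_ge0//.
by rewrite mulrCA mulrA.
Qed.

Lemma cvg_inv_sqrt : ((Num.sqrt n%:R)^-1 : R) @[n --> \oo] --> (0 : R).
Proof.
rewrite -sqrtr0; under eq_cvg do rewrite -sqrtrV ?ler0n//.
apply: continuous_cvg; first exact: sqrt_continuous.
have : (n.+1%:R^-1 : R) @[n --> \oo] --> (0 : R) by exact: cvg_harmonic.
by rewrite (cvg_shiftS (fun n => n%:R^-1 : R)).
Qed.

Lemma cvg_normalized_error k (X : nat -> bool) :
  (mom k (a_of X n) - normal_moment k (variance (a_of X n))) / Num.sqrt n%:R ^+ k
    @[n --> \oo] --> (0 : R).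
Proof.
(* At k = 0 the exponent k - 1 truncates to 0 and gains nothing, but there the error is exactly
   0. *)
case: k => [|k].
  apply: cvg_near_cst; apply: nearW => n.
  rewrite (mom_order0 mom_0 mom_double mom_doubleS) -[X in normal_moment X]/(2 * 0)%N.
  by rewrite normal_moment_double normal_coef0 expr0 mulr1 subrr mul0r.
have [C C0 HC] := mom_asymptotics (@mom_0 R) (@mom_double R) (@mom_doubleS R) k.+1.
apply/cvgrPdist_le => /= e e0.
(* a_X(n) has n+1 digits, and n+2 <= 4n for n >= 1 gives [root_length n.+1 <= 2 * Num.sqrt n%:R],
   hence 2^k. *)
have : (C * 2 ^+ k * (Num.sqrt n%:R)^-1) @[n --> \oo] --> (0 : R).
  rewrite -[X in _ --> X](mulr0 (C * 2 ^+ k)); apply: cvgM; first exact: cvg_cst.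
  exact: cvg_inv_sqrt.
move=> /cvgrPdist_le/(_ _ e0); apply: filterS2 (nbhs_infty_gt 0) => n n0.
rewrite !sub0r !normrN => Ce; apply: le_trans Ce.
have s0 : 0 < Num.sqrt n%:R :> R by rewrite sqrtr_gt0 ltr0n.
rewrite [leRHS]ger0_norm ?mulr_ge0 ?exprn_ge0 ?invr_ge0 ?(ltW s0)//.
rewrite normrM normfV (ger0_norm (exprn_ge0 k.+1 (ltW s0))) ler_pdivrMr ?exprn_gt0//.
have h := HC n.+1 _ (a_of_lt X n); rewrite subn1 /= in h; apply: (le_trans h).
rewrite exprS mulrA mulfVK ?gt_eqF// -mulrA ler_wpM2l// -exprMn.
rewrite lerXn2r ?nnegrE ?sqrtr_ge0 ?mulr_ge0 ?sqrtr_ge0//.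
have -> : 2 = Num.sqrt 4 :> R by rewrite (_ : 4 = 2 ^+ 2) ?sqrtr_sqr ?ger0_norm// -natrX.
by rewrite -sqrtrM// ler_sqrt ?mulr_ge0// -natrM ler_nat; lia.
Qed.

Lemma cvg_scaled_even k X : variance (a_of X n) / n%:R @[n --> \oo] --> (2^-1 : R) ->
  scaled_moment (2 * k) X n @[n --> \oo] --> (normal_coef k : R)%:E.
Proof.
move=> hV; under eq_cvg do rewrite scaled_momentE.
apply: cvg_EFin; first exact: nearW.
rewrite [X in X @ _ --> _](_ : _ = fun n : nat => Num.sqrt 2 ^+ (2 * k) *
    ((mom (2 * k) (a_of X n) - normal_moment (2 * k) (variance (a_of X n))) / Num.sqrt n%:R ^+ (2 * k))
  + normal_coef k * (2 * (variance (a_of X n) / n%:R)) ^+ k); last first.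
  apply/funext => n /=; rewrite normal_moment_double !exprM !sqr_sqrtr// !exprMn exprVn; ring.
rewrite -[X in _ --> X]add0r; apply: cvgD.
  by rewrite -[X in _ --> X](mulr0 (Num.sqrt 2 ^+ (2 * k))); apply: cvgM; [exact: cvg_cst|exact: cvg_normalized_error].
rewrite -[X in _ --> X]mulr1; apply: cvgM; first exact: cvg_cst.
rewrite -[X in _ --> X](expr1n _ k).
have h : 2 * (variance (a_of X n) / n%:R) @[n --> \oo] --> (1 : R).
  rewrite -[X in _ --> X](@divff _ (2 : R))//.
  by apply: cvgM; [exact: cvg_cst|exact: hV].
exact: (cvg_comp _ _ h (@exprn_continuous R k 1)).
Qed.

(** The normal moment of odd order is 0, so the normalized error is the whole quantity, for every
    sequence [X]. *)
Lemma cvg_scaled_odd k X : scaled_moment (2 * k + 1) X n @[n --> \oo] --> (0 : R)%:E.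
Proof.
under eq_cvg do rewrite scaled_momentE.
apply: cvg_EFin; first exact: nearW.
rewrite addn1 -[X in _ --> X](mulr0 (Num.sqrt 2 ^+ (2 * k).+1)).
apply: cvgM; first exact: cvg_cst.
have := @cvg_normalized_error (2 * k).+1 X.
by under eq_cvg do rewrite normal_moment_doubleS subr0.
Qed.
End assembly.

Theorem lemma3p8 (R : realType) (P : probability bitsequences R)
    (hP : balanced_bernoulli P) :
  {ae P, forall X : bitsequences, forall k : nat,
    (scaled_moment (2 * k) X n @[n --> \oo]
      --> (((2 * k)`!%:R / (2 ^+ k * k`!%:R) : R)%:E)) /\
    (scaled_moment (2 * k + 1) X n @[n --> \oo] --> (0 : R)%:E)} /\
  (forall k : nat,
    (\int[normal_prob (0 : R) 1]_x (x ^+ (2 * k))%:E =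
      ((2 * k)`!%:R / (2 ^+ k * k`!%:R))%:E)%E /\
    (\int[normal_prob (0 : R) 1]_x (x ^+ (2 * k + 1))%:E = 0)%E).
Proof.
split; last by move=> k; split; [exact: integral_normal_even_power|exact: integral_normal_odd_power].
pose m := @mom R.
have m0 := @mom_0 R; have m2 := @mom_double R; have m2S := @mom_doubleS R.
have [K K0 HK] := digitO_variance_step m0 m2 m2S.
(* A bound with exponent 0 does not depend on the length, so a itself can serve as the number of
   digits, by a < 2^a. *)
have dK a : `|mom_step m 2 a| <= K.
  by have := HK a a (ltn_expl a (ltnSn 1)); rewrite expr0 mulr1.
have V0 : second_moment m 0 = 0 by rewrite /second_moment /m m0.
have := ae_cvg_V_ratio hP V0 (variance_double m2)
  (variance_doubleS m0 m2 m2S) (variance_step_double m0 m2 m2S)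
  (variance_step_doubleS m0 m2 m2S) dK.
apply: filterS => X hX k; split; [exact: cvg_scaled_even|exact: cvg_scaled_odd].
Qed.
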